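(* Let $(\nabla^t,h_t)_{t\in]-\epsilon,\epsilon[}$ be a $C^2$-bounded variation of a uniformly hyperbolic bundle $(\nabla^0,h_0)$ in the fixed connection point of view, that is, $\nabla^t$ is the trivial connection $\mathrm D$ for all $t$. Let $\mathrm p_0$ denote the fundamental projector of $(\nabla^0,h_0)$ and $\dot{\mathrm p}_0$ the derivative at $t=0$ of the fundamental projector of $(\nabla^t,h_t)$. Then at a point $x$ in a geodesic $g$, $$\dot{\mathrm p}_0=[\dot A,\mathrm p_0]+\int_{g^+}[\mathrm d\dot A,\mathrm p_0]\cdot\mathrm p_0+\int_{g^-}\mathrm p_0\cdot[\mathrm d\dot A,\mathrm p_0]\ ,$$ where $g^+$ is the geodesic arc from $x$ to $g(+\infty)$, $g^-$ is the arc from $x$ to $g(-\infty)$ (that is, with the orientation opposite to $g$), and $\dot A$ is the section of $\mathrm{End}(E)$ such that $\dot A\cdot h_0=\left.\frac{\partial}{\partial t}\right|_{t=0}h_t$ (with $\dot A$ in the term $[\dot A,\mathrm p_0]$ evaluated at $x$).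
   Context: Uniformly hyperbolic bundles. $\mathsf U\mathbb H^2$ is the unit tangent bundle of the hyperbolic plane, $(\phi_t)$ its geodesic flow, generated by $\partial_s$; oriented geodesics $g$ are identified with flow orbits. $V$ is a finite-dimensional vector space, $E=V\times\mathsf U\mathbb H^2$. A frame $h$ on $E$ defines the metric $g_h$ for which it is orthonormal, with norms $\|\cdot\|_x$, angles $\angle_x(F,G)$ (infimum of angles of nonzero vectors) and distances $d_x$ of diameter $1$ on Grassmannians of $E_x$. $\Phi^\nabla_t$ is the lift of $\phi_t$ to $E$ by $\nabla$-parallel transport. $(\nabla,h)$ ($\nabla$ a trivializable connection) is a rank $k$ uniformly hyperbolic bundle if $\|\Phi^\nabla_{\pm1}\|$ are uniformly bounded and there is a flow invariant decomposition $E_x=L_x\oplus P_x$ (not a priori continuous), $\dim L_x=k$, such that: (1) some volume form on $E$ is bounded with respect to $h$ and $\nabla$-parallel along flow orbits; (2) there are $B,b>0$ with $\|\Phi^\nabla_s(u)\|_{\phi_s(x)}/\|u\|_x\le Be^{-bs}\|\Phi^\nabla_s(v)\|_{\phi_s(x)}/\|v\|_x$ for $s>0$, nonzero $u\in L_x$, $v\in P_x$; (3) elements of the fibres over $x$ of the closures of (the images of) $L$ and $P$ make an angle $>2\epsilon_0$, $\epsilon_0>0$ independent of $x$; (4) when $\nabla$ is trivialized, there is a continuous decomposition $E=L^\infty\oplus P^\infty$ of the same type with $\angle_x(L^\infty_x,P^\infty_x)>\epsilon_1>0$ and $d_x(L^\infty_x,L^\infty_y)\le Hd(x,y)^\alpha$,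 and the same for $P^\infty$. The fundamental projector is the projection on $L$ parallel to $P$; in the trivialization where the connection is trivial it is a constant element of $\mathrm{End}(V)$ along each geodesic. Bounded variation. A $C^k$-family of connections is $\nabla^t=\nabla^0+B^t$ with $t\mapsto B^t(\partial_s)$ of class $C^k$ with values in $C^0(K,\mathrm{End}(V))$ for each compact $K$. In the fixed frame view, a $C^k$-bounded variation of $(\nabla,h)$ is such a family with $\nabla^0=\nabla$ and $\dot\nabla_{\partial_s}$ uniformly bounded with respect to $g_h$ for $t$ near $0$. In general, it is a family $(\nabla^t,h_t)$ of smooth families for which there are smooth gauge transformations $G_t$ with $G_t^*h_t=h_0$ and $(G_t^*\nabla^t)$ a $C^k$-bounded variation in the fixed frame view. For small $t$ the bundles $(\nabla^t,h_t)$ are uniformly hyperbolic. In the fixed connection view $h_t=A_t(h_0)$ with $A_0=\mathrm{Id}$, and $\dot A$ is the derivative of $A_t$ at $0$. *)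

(* Defs.v *)
From HB Require Import structures.
From mathcomp Require Import all_boot all_order all_algebra.
From mathcomp Require Import all_classical all_reals all_analysis.
From mathcomp Require Import ring lra.

Set Implicit Arguments.
Unset Strict Implicit.
Unset Printing Implicit Defensive.

Import Order.TTheory GRing.Theory Num.Theory.
Import numFieldNormedType.Exports.

Local Open Scope classical_set_scope.
Local Open Scope ring_scope.

Section UnitTangentBundle.
Variable R : realType.

(* Hyperboloid model: H^2 is the sheet <p,p> = -1, p_0 > 0 in R^{2,1}, and a
   unit tangent vector is a pair (p, v) with <p,v> = 0 and <v,v> = 1. *)
Definition lorentz (a b : 'rV[R]_3) : R :=
  a 0 1 * b 0 1 + a 0 2 * b 0 2 - a 0 0 * b 0 0.

Definition unit_tangent : set ('rV[R]_3 * 'rV[R]_3) :=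
  [set q | [/\ lorentz q.1 q.1 = -1, 0 < q.1 0 0,
               lorentz q.1 q.2 = 0 & lorentz q.2 q.2 = 1]].

(* [set_type] carries the subspace topology. *)
Definition UH2 : Type := set_type unit_tangent.
HB.instance Definition _ := Topological.on UH2.

Definition foot (x : UH2) : 'rV[R]_3 := (\val x).1.
Definition dir (x : UH2) : 'rV[R]_3 := (\val x).2.

(* The Lorentzian cross product: lorentz (cross a b) c = det (a, b, c). For
   (p, v) in UH2, cross p v is v rotated by a right angle in T_p H^2. *)
Definition cross (a b : 'rV[R]_3) : 'rV[R]_3 :=
  \row_(i < 3) [:: a 0 2 * b 0 1 - a 0 1 * b 0 2;
                   a 0 2 * b 0 0 - a 0 0 * b 0 2;
                   a 0 0 * b 0 1 - a 0 1 * b 0 0]`_i.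

Definition ch (s : R) : R := (expR s + expR (- s)) / 2.
Definition sh (s : R) : R := (expR s - expR (- s)) / 2.

Lemma ch2_sh2 s : ch s ^+ 2 - sh s ^+ 2 = 1.
Proof.
have H : expR s * expR (- s) = 1 by rewrite expRxMexpNx_1.
rewrite /ch /sh.
by transitivity (expR s * expR (- s)); [field | exact: H].
Qed.

Lemma ch_gt0 s : 0 < ch s.
Proof. by rewrite /ch divr_gt0 // addr_gt0 // expR_gt0. Qed.

Lemma abs_sh_lt_ch s : `|sh s| < ch s.
Proof.
rewrite /ch /sh ltr_norml; have := expR_gt0 s; have := expR_gt0 (- s).
by move=> h1 h2; apply/andP; split; lra.
Qed.

Lemma timelike_gt0 (p u : 'rV[R]_3) s :
  lorentz p p = -1 -> 0 < p 0 0 -> lorentz p u = 0 -> lorentz u u = 1 ->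
  0 < ch s * p 0 0 + sh s * u 0 0.
Proof.
rewrite /lorentz => pp p0 pu uu.
have cs : (u 0 0) ^+ 2 < (p 0 0) ^+ 2.
  have := sqr_ge0 (p 0 1 * u 0 2 - p 0 2 * u 0 1).
  have e : (p 0 1 * u 0 2 - p 0 2 * u 0 1) ^+ 2 =
     (p 0 1 * p 0 1 + p 0 2 * p 0 2) * (u 0 1 * u 0 1 + u 0 2 * u 0 2)
       - (p 0 1 * u 0 1 + p 0 2 * u 0 2) ^+ 2 by ring.
  have E1 : p 0 1 * p 0 1 + p 0 2 * p 0 2 = p 0 0 ^+ 2 - 1 by rewrite expr2; lra.
  have E : u 0 1 * u 0 1 + u 0 2 * u 0 2 = u 0 0 ^+ 2 + 1 by rewrite expr2; lra.
  have E2 : p 0 1 * u 0 1 + p 0 2 * u 0 2 = p 0 0 * u 0 0 by lra.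
  rewrite E1 E E2 in e; rewrite e; nra.
have au : `|u 0 0| < p 0 0.
  by rewrite -(@ltr_pXn2r _ 2) ?nnegrE // ?ltW // real_normK ?num_real.
have hs := abs_sh_lt_ch s.
have : `|sh s * u 0 0| < ch s * p 0 0 by rewrite normrM ltr_pM.
by rewrite ltr_norml => /andP[? _]; lra.
Qed.

Lemma lorentz_cross_l (a b : 'rV[R]_3) : lorentz a (cross a b) = 0.
Proof. by rewrite /lorentz !mxE /=; ring. Qed.

Lemma lorentz_cross_r (a b : 'rV[R]_3) : lorentz b (cross a b) = 0.
Proof. by rewrite /lorentz !mxE /=; ring. Qed.

Lemma lorentz_cross2 (a b : 'rV[R]_3) :
  lorentz (cross a b) (cross a b) =
  lorentz a b ^+ 2 - lorentz a a * lorentz b b.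
Proof. by rewrite /lorentz !mxE /=; ring. Qed.

Lemma lorentzC a b : lorentz a b = lorentz b a.
Proof. by rewrite /lorentz; ring. Qed.

Lemma lorentz_lin (k l k' l' : R) (a b a' b' : 'rV[R]_3) :
  lorentz (k *: a + l *: b) (k' *: a' + l' *: b') =
  k * k' * lorentz a a' + k * l' * lorentz a b' +
  l * k' * lorentz b a' + l * l' * lorentz b b'.
Proof. by rewrite /lorentz !mxE; ring. Qed.

Lemma geodesic_subproof s (x : UH2) :
  unit_tangent (ch s *: foot x + sh s *: dir x, sh s *: foot x + ch s *: dir x).
Proof.
have [pp p0 pv vv] : unit_tangent (foot x, dir x).
  by case: (set_mem (valP x)).
move: (foot x) (dir x) pp p0 pv vv => p v /= pp p0 pv vv.
have := ch2_sh2 s => cs.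
split => /=; rewrite ?lorentz_lin ?(lorentzC v p) ?pp ?pv ?vv.
- by transitivity (- (ch s ^+ 2 - sh s ^+ 2)); [ring | rewrite cs].
- by rewrite !mxE; apply: timelike_gt0.
- by ring.
- by transitivity (ch s ^+ 2 - sh s ^+ 2); [ring | rewrite cs].
Qed.

Lemma transverse_subproof s (x : UH2) :
  unit_tangent (ch s *: foot x + sh s *: cross (foot x) (dir x), dir x).
Proof.
have [pp p0 pv vv] : unit_tangent (foot x, dir x).
  by case: (set_mem (valP x)).
move: (foot x) (dir x) pp p0 pv vv => p v /= pp p0 pv vv.
have cc : lorentz (cross p v) (cross p v) = 1.
  by rewrite lorentz_cross2 pp pv vv; ring.
have := ch2_sh2 s => cs.
split => //=.
- rewrite lorentz_lin (lorentzC (cross p v) p) lorentz_cross_l pp cc.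
  by transitivity (- (ch s ^+ 2 - sh s ^+ 2)); [ring | rewrite cs].
- rewrite 2!mxE [X in _ + X]mxE; apply: timelike_gt0 => //.
  exact: lorentz_cross_l.
- rewrite -[X in lorentz _ X]scale1r -[X in lorentz _ X]addr0.
  rewrite -[X in lorentz _ (_ + X)](scale0r v) lorentz_lin.
  by rewrite (lorentzC (cross p v) v) lorentz_cross_r pv; ring.
Qed.

Lemma rotation_subproof s (x : UH2) :
  unit_tangent (foot x, cos s *: dir x + sin s *: cross (foot x) (dir x)).
Proof.
have [pp p0 pv vv] : unit_tangent (foot x, dir x).
  by case: (set_mem (valP x)).
move: (foot x) (dir x) pp p0 pv vv => p v /= pp p0 pv vv.
have cc : lorentz (cross p v) (cross p v) = 1.
  by rewrite lorentz_cross2 pp pv vv; ring.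
split => //=.
- rewrite -[X in lorentz X _]scale1r -[X in lorentz X _]addr0.
  rewrite -[X in lorentz (_ + X) _](scale0r v) lorentz_lin.
  by rewrite lorentz_cross_l pv; ring.
- rewrite lorentz_lin (lorentzC (cross p v) v) lorentz_cross_r vv cc.
  by transitivity (cos s ^+ 2 + sin s ^+ 2); [ring | exact: cos2Dsin2].
Qed.

(* The geodesic flow phi_s; the oriented geodesics are its orbits. *)
Definition geodesic (s : R) (x : UH2) : UH2 :=
  SigSub (mem_set (geodesic_subproof s x)).

(* Moves the foot point along the geodesic orthogonal to the vector, the vector
   being transported parallelly. *)
Definition transverse (s : R) (x : UH2) : UH2 :=
  SigSub (mem_set (transverse_subproof s x)).

Definition rotation (s : R) (x : UH2) : UH2 :=
  SigSub (mem_set (rotation_subproof s x)).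

(* The generators of these three flows form a global frame of T(UH2), which is
   orthonormal for the Sasaki metric; [Flow] stands for d/ds. *)
Inductive field := Flow | Transverse | Vertical.

Definition flow (X : field) : R -> UH2 -> UH2 :=
  match X with
  | Flow => geodesic
  | Transverse => transverse
  | Vertical => rotation
  end.

Section Smooth.
Variable W : normedModType R.

Definition derive_along (X : field) (f : UH2 -> W) (x : UH2) : W :=
  derive1 (fun s : R => f (flow X s x)) 0.

Fixpoint Ck (m : nat) (f : UH2 -> W) : Prop :=
  match m with
  | 0 => continuous f
  | m'.+1 => continuous f /\
      forall X, (forall x, derivable (fun s : R => f (flow X s x)) 0 1) /\
                Ck m' (derive_along X f)
  end.

(* As the three fields span the tangent spaces, this is C^infinity smoothness
   on the manifold UH2. *)
Definition smooth (f : UH2 -> W) : Prop := forall m, Ck m f.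

End Smooth.

(* The Riemannian distance of the Sasaki metric |p'|^2 + |D v/dt|^2, where
   D v/dt = v' + <v',p> p is the covariant derivative of v along p. *)
Definition C1_curve (c : R -> UH2) : Prop :=
  [/\ forall t, derivable (foot \o c) t 1, continuous (derive1 (foot \o c)),
      forall t, derivable (dir \o c) t 1 & continuous (derive1 (dir \o c))].

Definition speed (c : R -> UH2) (t : R) : R :=
  let p' := derive1 (foot \o c) t in
  let v' := derive1 (dir \o c) t in
  Num.sqrt (lorentz p' p' + (lorentz v' v' + lorentz v' (foot (c t)) ^+ 2)).

Definition curve_length (c : R -> UH2) : R :=
  \int[lebesgue_measure]_(t in `[0, 1]) speed c t.

Definition UH2_dist (x y : UH2) : R :=
  inf [set curve_length c | c in [set c | [/\ C1_curve c, c 0 = x & c 1 = y]]].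

End UnitTangentBundle.

Arguments geodesic {R}.

Section Bundle.
Variables (R : realType) (n : nat).

(* V = R^n, as column vectors, and End(V) = 'M[R]_n. *)
Local Notation UH2 := (UH2 R).
Local Notation V := 'cV[R]_n.
Local Notation End := 'M[R]_n.

(* A frame is given by the matrices h x whose columns are the basis of E_x, so
   that endomorphisms act on frames by left multiplication. *)
Definition is_frame (h : UH2 -> End) : Prop :=
  smooth h /\ forall x, h x \in unitmx.

Definition is_gauge (G : UH2 -> End) : Prop :=
  smooth G /\ forall x, G x \in unitmx.

Definition inner (h : UH2 -> End) (x : UH2) (u v : V) : R :=
  \sum_i (invmx (h x) *m u) i 0 * (invmx (h x) *m v) i 0.

Definition fnorm (h : UH2 -> End) (x : UH2) (u : V) : R :=
  Num.sqrt (inner h x u u).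

(* Extended real valued: +oo if one of the subspaces is 0. *)
Definition angle (h : UH2 -> End) (x : UH2) (F G : {vspace V}) : \bar R :=
  ereal_inf [set a | exists u v, [/\ u \in F, u != 0, v \in G, v != 0 &
    a = (acos (inner h x u v / (fnorm h x u * fnorm h x v)))%:E]].

(* The gap distance, i.e. the operator norm of the difference of the orthogonal
   projections for g_h at x; it has diameter 1. *)
Definition dist_to (h : UH2 -> End) (x : UH2) (u : V) (G : {vspace V}) : R :=
  inf [set fnorm h x (u - v) | v in [set v | v \in G]].

Definition grass_dist (h : UH2 -> End) (x : UH2) (F G : {vspace V}) : R :=
  Num.max
    (sup [set dist_to h x u G | u in [set u | u \in F /\ fnorm h x u = 1]])
    (sup [set dist_to h x v F | v in [set v | v \in G /\ fnorm h x v = 1]]).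

(* F belongs to the fibre over x of the closure, in the Grassmann bundle of E,
   of the image of the section L. *)
Definition in_closure (h : UH2 -> End) (L : UH2 -> {vspace V}) (x : UH2)
    (F : {vspace V}) : Prop :=
  \dim F = \dim (L x) /\
  forall (e : R) (U : set UH2), 0 < e -> nbhs x U ->
    exists y, U y /\ grass_dist h x (L y) F < e.

(* The connection D + omega on E, D being the trivial connection, is given by
   the components omega(X) of omega in the global frame of T(UH2). *)
Definition connection : Type := field -> UH2 -> End.

Definition is_connection (nabla : connection) : Prop :=
  forall X, smooth (nabla X).

Definition trivial_connection : connection := fun _ _ => 0.

(* G^*nabla = G^-1 o nabla o G, and G^*h = G^-1 h. *)
Definition pullback_connection (G : UH2 -> End) (nabla : connection) :
    connection := fun X x =>
  invmx (G x) *m nabla X x *m G x + invmx (G x) *m derive_along X G x.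

Definition pullback_frame (G : UH2 -> End) (h : UH2 -> End) : UH2 -> End :=
  fun x => invmx (G x) *m h x.

Definition trivializes (G : UH2 -> End) (nabla : connection) : Prop :=
  is_gauge G /\
  forall X x, pullback_connection G nabla X x = trivial_connection X x.

(* Phi s x : E_x -> E_{phi_s x} is the nabla-parallel transport along phi. *)
Definition is_transport (nabla : connection) (Phi : R -> UH2 -> End) : Prop :=
  forall x, Phi 0 x = 1%:M /\
    forall s : R, is_derive s 1 (fun r : R => Phi r x)
      (- (nabla Flow (geodesic s x) *m Phi s x)).

Definition is_splitting (k : nat) (L P : UH2 -> {vspace V}) : Prop :=
  forall x, [/\ \dim (L x) = k, (L x + P x)%VS = fullv & (L x :&: P x)%VS = 0%VS].

Definition flow_invariant (Phi : R -> UH2 -> End) (L : UH2 -> {vspace V}) :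
    Prop :=
  forall s x u, (u \in L x) = (Phi s x *m u \in L (geodesic s x)).

(* The volume form is f(x) det on E_x; its value on the frame is f(x) det(h x). *)
Definition bounded_parallel_volume (h : UH2 -> End) (Phi : R -> UH2 -> End) :
    Prop :=
  exists f : UH2 -> R^o,
    [/\ smooth f, forall x, f x != 0,
        exists C : R, forall x, `|f x * \det (h x)| <= C &
        forall s x, f (geodesic s x) * \det (Phi s x) = f x].

Definition dominated (h : UH2 -> End) (Phi : R -> UH2 -> End)
    (L P : UH2 -> {vspace V}) : Prop :=
  exists B b : R, [/\ 0 < B, 0 < b &
    forall (x : UH2) (s : R) (u v : V), 0 < s ->
      u \in L x -> u != 0 -> v \in P x -> v != 0 ->
      fnorm h (geodesic s x) (Phi s x *m u) / fnorm h x u <=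
      B * expR (- (b * s)) *
        (fnorm h (geodesic s x) (Phi s x *m v) / fnorm h x v)].

Definition closure_transverse (h : UH2 -> End) (L P : UH2 -> {vspace V}) :
    Prop :=
  exists e0 : R, 0 < e0 /\
    forall x F G, in_closure h L x F -> in_closure h P x G ->
      ((2 * e0)%:E < angle h x F G)%E.

Definition holder (h : UH2 -> End) (L : UH2 -> {vspace V}) : Prop :=
  exists H alpha : R, 0 < alpha /\
    forall x y, grass_dist h x (L x) (L y) <= H * UH2_dist x y `^ alpha.

Definition continuous_subbundle (h : UH2 -> End) (L : UH2 -> {vspace V}) :
    Prop :=
  forall x, grass_dist h x (L x) (L y) @[y --> x] --> (0 : R).

(* Here h is meant to be read in a trivialization of the connection, where the
   fibres over different points are identified. The splitting need not be flow
   invariant. *)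
Definition holder_splitting (k : nat) (h : UH2 -> End) : Prop :=
  exists Linf Pinf : UH2 -> {vspace V},
    [/\ is_splitting k Linf Pinf,
        continuous_subbundle h Linf /\ continuous_subbundle h Pinf,
        exists e1 : R, 0 < e1 /\
          forall x, (e1%:E < angle h x (Linf x) (Pinf x))%E,
        holder h Linf & holder h Pinf].

Definition uniformly_hyperbolic_with (k : nat) (nabla : connection)
    (h : UH2 -> End) (L P : UH2 -> {vspace V}) : Prop :=
  [/\ is_frame h, is_connection nabla,
      is_splitting k L P,
      exists Phi : R -> UH2 -> End,
        [/\ is_transport nabla Phi,
            exists C : R, forall x u,
              fnorm h (geodesic 1 x) (Phi 1 x *m u) <= C * fnorm h x u /\
              fnorm h (geodesic (-1) x) (Phi (-1) x *m u) <= C * fnorm h x u,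
            flow_invariant Phi L /\ flow_invariant Phi P,
            bounded_parallel_volume h Phi &
            dominated h Phi L P] &
      closure_transverse h L P /\
      exists G, trivializes G nabla /\
                holder_splitting k (pullback_frame G h)].

Definition uniformly_hyperbolic (k : nat) (nabla : connection)
    (h : UH2 -> End) : Prop :=
  exists L P, uniformly_hyperbolic_with k nabla h L P.

Definition fundamental_projector (k : nat) (nabla : connection)
    (h p : UH2 -> End) : Prop :=
  exists L P, uniformly_hyperbolic_with k nabla h L P /\
    forall x, (forall u, u \in L x -> p x *m u = u) /\
              (forall v, v \in P x -> p x *m v = 0).

(* t |-> F t is of class C^m on ]-eps, eps[ with values in C^0(K, End(V)) for
   every compact K: limits are uniform on every compact set. *)
Fixpoint Ck_family (eps : R) (m : nat) (F : R -> UH2 -> End) : Prop :=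
  match m with
  | 0 => forall t : R, `|t| < eps ->
      continuous (F t) /\ {family compact, F r @[r --> t] --> F t}
  | m'.+1 => (forall t : R, `|t| < eps -> continuous (F t)) /\
      exists dF : R -> UH2 -> End, Ck_family eps m' dF /\
        forall t : R, `|t| < eps ->
          {family compact,
             (fun x => r^-1 *: (F (t + r) x - F t x)) @[r --> (0 : R)^']
             --> dF t}
  end.

Definition fixed_frame_bounded_variation (eps : R) (m : nat)
    (nabla : connection) (h : UH2 -> End) (nablat : R -> connection) : Prop :=
  let B := fun (t : R) (x : UH2) => nablat t Flow x - nabla Flow x in
  [/\ forall t, `|t| < eps -> is_connection (nablat t),
      forall X x, nablat 0 X x = nabla X x,
      Ck_family eps m B &
      exists C : R, \forall t \near (0 : R), forall x u,
        fnorm h x (derive1 (fun r : R => B r x) t *m u) <= C * fnorm h x u].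

(* The family (nablat t, ht t), for t in ]-eps, eps[, is a C^m-bounded variation
   of (nablat 0, ht 0). The families of connections and of frames are only asked
   to be of class C^m with respect to t. *)
Definition bounded_bundle_variation (eps : R) (m : nat)
    (nablat : R -> connection) (ht : R -> UH2 -> End) : Prop :=
  [/\ forall t, `|t| < eps -> is_connection (nablat t) /\ is_frame (ht t),
      forall X, Ck_family eps m (fun t => nablat t X),
      Ck_family eps m ht &
      exists G : R -> UH2 -> End,
        (forall t, `|t| < eps ->
           is_gauge (G t) /\ forall x, pullback_frame (G t) (ht t) x = ht 0 x) /\
        fixed_frame_bounded_variation eps m (nablat 0) (ht 0)
          (fun t => pullback_connection (G t) (nablat t))].

Definition bracket (A B : End) : End := A *m B - B *m A.

Definition mx_integrable (F : R -> End) : Prop :=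
  forall i j, lebesgue_measure.-integrable `[0, +oo[ (fun s => (F s i j)%:E).

Definition mx_integral (F : R -> End) : End :=
  \matrix_(i, j) \int[lebesgue_measure]_(s in `[0, +oo[) F s i j.

(* The pullback of [dA, p] to the arc c; its integral over s >= 0 is the line
   integral of the 1-form along c. *)
Definition bracket_dA (A p : UH2 -> End) (c : R -> UH2) (s : R) : End :=
  bracket (derive1 (A \o c) s) (p (c s)).

End Bundle.

Arguments trivial_connection {R n}.

(* The arcs of the geodesic through x from x to its endpoints at +oo and -oo,
   parametrized by s >= 0. *)
Definition arc_plus (R : realType) (x : UH2 R) (s : R) : UH2 R := geodesic s x.
Definition arc_minus (R : realType) (x : UH2 R) (s : R) : UH2 R :=
  geodesic (- s) x.

(* Main.v *)
(* Write G_t = h_t h_0^-1, so that h_t-norms of constant vectors are h_0-norms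
   of their images under G_t^-1, and let q_t = G_t^-1 p_t G_t. Along a geodesic,
   G_t^-1 d/ds G_t is O(t) uniformly for the h_0-norm. A cone field argument,
   together with the fact that a dominated splitting is determined by its rank,
   then shows that q_t - p_0 = O(t) for the h_0-norm, uniformly along the
   geodesic. Since p_t is constant along the geodesic and equal to
   G_t q_t G_t^-1 at each of its points, at any time s,
     (p_t - p_0) / t = [Adot(s), p_0] + (q_t(s) - p_0) / t + o(1).
   By domination, the contribution of the second term to the block
   p_0 (.) (1 - p_0) at time 0 is O(exp(b s)) as s tends to -oo, so this block
   converges to the limit of - p_0 Adot(s) (1 - p_0) at -oo, which is an integral
   of d Adot. The block (1 - p_0) (.) p_0 is treated in the same way at +oo, and
   the diagonal blocks are O(t) because p_t and p_0 are idempotent. *)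
Require Import Defs.
From HB Require Import structures.
From mathcomp Require Import all_boot all_order all_algebra.
From mathcomp Require Import all_classical all_reals all_analysis.
From mathcomp Require Import measurable_realfun ring lra.
Import Order.TTheory GRing.Theory Num.Theory.
Import numFieldNormedType.Exports.
Local Open Scope classical_set_scope.
Local Open Scope ring_scope.

Set Implicit Arguments.
Unset Strict Implicit.
Unset Printing Implicit Defensive.

(** * Euclidean norms of frames *)

(** For t != 0 the constants of hyperbolicity of [h t] are not bounded uniformly in t, so they may
    not enter any estimate that has to be O(t). This dictates the cone argument: they occur only as
    a fixed factor in front of an exponentially small term, in a limit of long time, and the
    constants that survive are those of [h 0]. A second obstacle is that transport is bounded over
    times 1 and -1 only, which leaves the norms at intermediate times free. Domination on both sides
    of an intermediate time compares them up to a scalar independent of the vector, and operator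
    norms do not see that scalar. This needs nonzero vectors in both summands, so ranks 0 and n are
    treated apart. A third one is that [Adot] is a pointwise derivative in t: its differentiability
    along the flow has to be proved, by exchanging the two derivatives through the locally uniform
    convergence of t^-1 G_t^-1 dG_t/ds. *)

Lemma eq_ler (R : numDomainType) (x y : R) : x = y -> x <= y.
Proof. by move=> ->. Qed.

Section EuclideanNorm.
Context {R : realType} {n : nat}.
Implicit Types (u v w : 'cV[R]_n) (a M : 'M[R]_n).

Definition edot u v : R := \sum_i u i 0 * v i 0.
Definition enorm u : R := Num.sqrt (edot u u).

Lemma edotC u v : edot u v = edot v u.
Proof. by apply: eq_bigr => i _; rewrite mulrC. Qed.

Lemma edotDl u v w : edot (u + v) w = edot u w + edot v w.
Proof. by rewrite -big_split; apply: eq_bigr => i _; rewrite mxE mulrDl. Qed.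

Lemma edotZl (c : R) u v : edot (c *: u) v = c * edot u v.
Proof. by rewrite mulr_sumr; apply: eq_bigr => i _; rewrite mxE mulrA. Qed.

Lemma edotDr u v w : edot w (u + v) = edot w u + edot w v.
Proof. by rewrite edotC edotDl !(edotC w). Qed.

Lemma edotZr (c : R) u v : edot u (c *: v) = c * edot u v.
Proof. by rewrite edotC edotZl edotC. Qed.

Lemma edot0r u : edot u 0 = 0.
Proof. by rewrite -(scale0r (0 : 'cV[R]_n)) edotZr mul0r. Qed.

Lemma edotNl u v : edot (- u) v = - edot u v.
Proof. by rewrite -scaleN1r edotZl mulN1r. Qed.

Lemma edotBl u v w : edot (u - v) w = edot u w - edot v w.
Proof. by rewrite edotDl edotNl. Qed.

Lemma edotE u v : edot u v = (u^T *m v) 0 0.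
Proof. by rewrite mxE; apply: eq_bigr => i _; rewrite mxE. Qed.

Lemma edot_trmx M u v : edot (M^T *m u) v = edot u (M *m v).
Proof. by rewrite !edotE trmx_mul trmxK mulmxA. Qed.

Lemma edot_ge0 u : 0 <= edot u u.
Proof. by apply: sumr_ge0 => i _; rewrite -expr2 sqr_ge0. Qed.

Lemma edot_eq0 u : edot u u = 0 -> u = 0.
Proof.
move=> /eqP; rewrite psumr_eq0 => [/allP H|i _]; last by rewrite -expr2 sqr_ge0.
apply/colP => i; have := H i (mem_index_enum i).
by rewrite mxE mulf_eq0 orbb => /eqP.
Qed.

Lemma enorm_ge0 u : 0 <= enorm u.
Proof. exact: sqrtr_ge0. Qed.

Lemma enorm2 u : enorm u ^+ 2 = edot u u.
Proof. by rewrite sqr_sqrtr // edot_ge0. Qed.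

Lemma enorm_eq0 u : enorm u = 0 -> u = 0.
Proof. by move=> h; apply: edot_eq0; rewrite -enorm2 h expr0n. Qed.

Lemma enorm0 : enorm 0 = 0.
Proof. by rewrite /enorm edot0r sqrtr0. Qed.

Lemma enormZ (c : R) u : enorm (c *: u) = `|c| * enorm u.
Proof.
by rewrite /enorm edotZl edotZr mulrA -expr2 sqrtrM ?sqr_ge0 // sqrtr_sqr.
Qed.

Lemma edot_le u v : `|edot u v| <= enorm u * enorm v.
Proof.
have [v0|vn0] := eqVneq (edot v v) 0.
  by rewrite (edot_eq0 v0) enorm0 mulr0 edot0r normr0.
have vv : 0 < edot v v by rewrite lt_neqAle eq_sym vn0 edot_ge0.
have := edot_ge0 (edot v v *: u - edot u v *: v).
rewrite edotBl edotZl edotZl ![edot _ (_ - _)]edotC !edotBl !edotZl.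
rewrite (edotC v u).
set A := edot u u; set B := edot v v; set C := edot u v => h.
have {h} : 0 <= B * (A * B - C ^+ 2) by rewrite expr2; lra.
rewrite pmulr_rge0 // subr_ge0 => h.
rewrite -sqrtr_sqr -sqrtrM ?edot_ge0 //.
by apply: ler_wsqrtr.
Qed.

Lemma ler_enormD u v : enorm (u + v) <= enorm u + enorm v.
Proof.
rewrite -(@ler_pXn2r _ 2) ?nnegrE ?addr_ge0 ?enorm_ge0 // enorm2.
rewrite edotDl !edotDr (edotC v u) sqrrD !enorm2.
have := le_trans (ler_norm _) (edot_le u v); lra.
Qed.

Lemma enorm_col u i : `|u i 0| <= enorm u.
Proof.
rewrite -sqrtr_sqr; apply: ler_wsqrtr; rewrite /edot (bigD1 i) //= expr2 lerDl.
by apply: sumr_ge0 => j _; rewrite -expr2 sqr_ge0.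
Qed.

Lemma enorm_delta i : enorm (delta_mx i 0) = 1.
Proof.
rewrite /enorm /edot (bigD1 i) //= big1 => [|j ji]; rewrite !mxE !eqxx ?mulr1.
  by rewrite addr0 sqrtr1.
by rewrite (negbTE ji) mul0r.
Qed.

Lemma enorm_le_sum u : enorm u <= \sum_i `|u i 0|.
Proof.
rewrite -[in leLHS](mulmx1 u).
have -> : u *m 1%:M = \sum_i u i 0 *: delta_mx i 0.
  rewrite mulmx1; apply/colP => i; rewrite summxE (bigD1 i) //= big1.
    by rewrite !mxE !eqxx mulr1 addr0.
  by move=> j ji; rewrite !mxE eq_sym (negbTE ji) mulr0.
elim/big_ind2: _ => [|x y x' y' h1 h2|i _]; first by rewrite enorm0.
  by rewrite (le_trans (ler_enormD _ _)) // lerD.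
by rewrite enormZ enorm_delta mulr1.
Qed.

(** From |M^T u|^2 = <u, M (M^T u)> and Cauchy-Schwarz. It turns equations with multiplication on
    the right into equations with multiplication on the left. *)
Lemma enorm_trmx M (c : R) : (forall u, enorm (M *m u) <= c * enorm u) ->
  forall u, enorm (M^T *m u) <= c * enorm u.
Proof.
move=> Mc u; set w := M^T *m u.
have [->|w0] := eqVneq w 0.
  rewrite enorm0; have [->|u0] := eqVneq u 0; first by rewrite enorm0 mulr0.
  by apply: le_trans (Mc u); apply: enorm_ge0.
have wgt0 : 0 < enorm w.
  by rewrite lt_neqAle enorm_ge0 eq_sym andbT; apply: contra w0 => /eqP/enorm_eq0->.
rewrite -(ler_pM2r wgt0) -expr2 enorm2 {1}/w edot_trmx.
apply: le_trans (ler_norm _) _; apply: le_trans (edot_le _ _) _.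
by rewrite (mulrC c) -mulrA ler_wpM2l ?enorm_ge0.
Qed.

(* The norm for which the columns of [invmx a] are orthonormal. *)
Definition onorm a u : R := enorm (a *m u).

Lemma onorm_ge0 a u : 0 <= onorm a u.
Proof. exact: enorm_ge0. Qed.

Lemma onorm0 a : onorm a 0 = 0.
Proof. by rewrite /onorm mulmx0 enorm0. Qed.

Lemma onormZ a (c : R) u : onorm a (c *: u) = `|c| * onorm a u.
Proof. by rewrite /onorm -scalemxAr enormZ. Qed.

Lemma onormN a u : onorm a (- u) = onorm a u.
Proof. by rewrite -scaleN1r onormZ normrN1 mul1r. Qed.

Lemma ler_onormD a u v : onorm a (u + v) <= onorm a u + onorm a v.
Proof. by rewrite /onorm mulmxDr ler_enormD. Qed.

Lemma ler_onormB a u v : onorm a (u - v) <= onorm a u + onorm a v.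
Proof. by rewrite -(onormN a v) ler_onormD. Qed.

Lemma lerB_onorm a u v : onorm a u - onorm a v <= onorm a (u + v).
Proof. by rewrite lerBlDr -{1}(addrK v u) -(onormN a v) ler_onormD. Qed.

Lemma onorm_gt0 a u : a \in unitmx -> u != 0 -> 0 < onorm a u.
Proof.
move=> aU u0; rewrite lt_neqAle onorm_ge0 eq_sym andbT.
apply: contra u0 => /eqP /enorm_eq0 h.
by rewrite -(mulKmx aU u) h mulmx0.
Qed.

Lemma onorm_eq0 a u : a \in unitmx -> onorm a u <= 0 -> u = 0.
Proof.
move=> aU h; apply/eqP; apply/negPn/negP => /(onorm_gt0 aU).
by rewrite ltNge h.
Qed.

(** All norms on matrices are equivalent; what matters is that [c] depends on [a] only. The entry is
    read off by testing [M] on a basis vector. *)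
Lemma onorm_entry a : a \in unitmx -> exists2 c : R, 0 < c &
  forall M (m : R), 0 <= m -> (forall u, onorm a (M *m u) <= m * onorm a u) ->
  forall i j, `|M i j| <= c * m.
Proof.
move=> aU.
pose c1 : R := \sum_i \sum_j `|invmx a i j|.
pose c2 : R := \sum_j onorm a (delta_mx j 0).
have c1p : 0 <= c1 by apply: sumr_ge0 => i _; apply: sumr_ge0.
have c2p : 0 <= c2 by apply: sumr_ge0 => i _; apply: onorm_ge0.
exists (c1 * c2 + 1); first by rewrite ltr_wpDl // mulr_ge0.
move=> M m m0 Mm i j.
have -> : M i j = (invmx a *m (a *m (M *m delta_mx j (0 : 'I_1)))) i 0.
  rewrite mulKmx // mxE (bigD1 j) //= big1 => [|k kj].
    by rewrite mxE !eqxx mulr1 addr0.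
  by rewrite mxE (negbTE kj) mulr0.
rewrite [leLHS](_ : _ = `|\sum_k invmx a i k * (a *m (M *m delta_mx j (0 : 'I_1))) k 0|);
  last by rewrite mxE.
apply: le_trans (ler_norm_sum _ _ _) _.
have H k : `|invmx a i k * (a *m (M *m delta_mx j (0 : 'I_1))) k 0| <=
    `|invmx a i k| * (c2 * m).
  rewrite normrM ler_wpM2l //; apply: le_trans (enorm_col _ _) _.
  apply: le_trans (Mm _) _; rewrite mulrC; apply: ler_wpM2r => //.
  rewrite /c2 (bigD1 j) //=; apply: ler_wpDr => //.
  by apply: sumr_ge0 => l _; apply: onorm_ge0.
apply: le_trans (ler_sum _ (fun k _ => H k)) _.
rewrite -mulr_suml.
have : \sum_k `|invmx a i k| <= c1.
  rewrite /c1 [leRHS](bigD1 i) //= lerDl.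
  by apply: sumr_ge0 => l _; apply: sumr_ge0.
move=> h; apply: le_trans (ler_wpM2r (mulr_ge0 c2p m0) h) _.
by rewrite mulrDl mul1r mulrA lerDl.
Qed.

Lemma enorm_mulmx_entry M (m : R) : (forall i j, `|M i j| <= m) ->
  forall u, enorm (M *m u) <= n%:R ^+ 2 * m * enorm u.
Proof.
move=> Mm u; apply: le_trans (enorm_le_sum _) _.
have H i : `|(M *m u) i 0| <= n%:R * m * enorm u.
  rewrite mxE; apply: le_trans (ler_norm_sum _ _ _) _.
  rewrite -mulrA mulr_natl.
  have -> : m * enorm u *+ n = \sum_(j < n) m * enorm u.
    by rewrite sumr_const card_ord.
  apply: ler_sum => j _; rewrite normrM ler_pM //; exact: enorm_col.
apply: le_trans (ler_sum _ (fun i _ => H i)) _.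
by rewrite sumr_const card_ord -[leLHS]mulr_natl expr2 !mulrA.
Qed.

End EuclideanNorm.

(** * Invariance of cone fields *)

Section ConeField.
Context {R : realType} {n : nat}.
(** Discrete times along an orbit: [onorm (a m)] is the unperturbed norm at time m, and [W m]
    carries the perturbed norm to it, so that [onorm (a m) (W m *m u)] is the perturbed norm of the
    constant vector [u]. A step first replaces [W m] by [W m.+1] in the norm of time m, then changes
    the norm. *)
Variables (a W : nat -> 'M[R]_n) (p pc : 'M[R]_n) (K kappa theta : R).
Hypothesis aU : forall m, a m \in unitmx.
Hypothesis WU : forall m, W m \in unitmx.
Hypothesis ppc : p + pc = 1%:M.
Hypothesis K0 : 0 <= K.
Hypothesis pK : forall m u, onorm (a m) (p *m u) <= K * onorm (a m) u.
Hypothesis pcK : forall m u, onorm (a m) (pc *m u) <= K * onorm (a m) u.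
Hypothesis p_pc_dominated : forall m u v,
  onorm (a m.+1) (p *m u) * onorm (a m) (pc *m v) <=
  kappa * (onorm (a m.+1) (pc *m v) * onorm (a m) (p *m u)).
Hypothesis kappa0 : 0 <= kappa.
Hypothesis kappa8 : 8 * kappa <= 1.
Hypothesis theta0 : 0 < theta.
Hypothesis Ktheta : 16 * (K * theta) <= 1.
Hypothesis W_step : forall m u,
  onorm (a m) (W m.+1 *m u - W m *m u) <= theta * onorm (a m) (W m *m u).

Let A m (u : 'cV[R]_n) := onorm (a m) (p *m (W m *m u)).
Let D m (u : 'cV[R]_n) := onorm (a m) (pc *m (W m *m u)).
(** Outside the cone [K * theta * A] is less than [D / 4], and [K * theta * D] is at most [D / 16],
    so the error [K * theta * (A + D)] of one step is less than half of [D]. *)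
Let delta := 4 * (K * theta).

Let A0 m u : 0 <= A m u. Proof. exact: onorm_ge0. Qed.
Let D0 m u : 0 <= D m u. Proof. exact: onorm_ge0. Qed.

Let AD m u : onorm (a m) (W m *m u) <= A m u + D m u.
Proof. by rewrite -{1}(mul1mx (W m *m u)) -ppc mulmxDl ler_onormD. Qed.

Let delta4 : delta <= 1 / 4.
Proof. by have := Ktheta; rewrite /delta; lra. Qed.

Let Kt0 : 0 <= K * theta. Proof. by rewrite mulr_ge0 // ltW. Qed.

Let proj_step (c : 'M[R]_n) m u :
  (forall v, onorm (a m) (c *m v) <= K * onorm (a m) v) ->
  onorm (a m) (c *m (W m.+1 *m u) - c *m (W m *m u)) <=
    K * theta * (A m u + D m u).
Proof.
move=> cK; rewrite -mulmxBr; apply: le_trans (cK _) _; rewrite -mulrA ler_wpM2l //.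
apply: le_trans (W_step _ _) _; rewrite ler_wpM2l ?AD //; exact: ltW.
Qed.

Let p_step m u :
  onorm (a m) (p *m (W m.+1 *m u)) <= A m u + K * theta * (A m u + D m u).
Proof.
rewrite -lerBlDl; apply: le_trans (proj_step u (pK m)).
rewrite -[X in _ - X <= _]onormN; exact: lerB_onorm.
Qed.

Let pc_step m u :
  D m u - K * theta * (A m u + D m u) <= onorm (a m) (pc *m (W m.+1 *m u)).
Proof.
rewrite lerBlDr -lerBlDl; apply: le_trans (proj_step u (pcK m)).
rewrite -[leRHS]onormN opprB -[X in _ - X <= _]onormN; exact: lerB_onorm.
Qed.

(* The complement of the cone [D <= delta * A] around the range of [p] is
   invariant forward in time, and the cone itself backward. *)
Let step m u : delta * A m u < D m u ->
  delta * A m.+1 u < D m.+1 u /\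
  D m u <= 2 * onorm (a m) (pc *m (W m.+1 *m u)).
Proof.
move=> h.
have h0 : 0 < D m u by apply: le_lt_trans h; rewrite mulr_ge0 // mulr_ge0.
have h2 : K * theta * (A m u + D m u) <= D m u / 2.
  have := ler_wpM2r (D0 m u) Ktheta; rewrite /delta in h; lra.
have h3 := pc_step m u.
have h1 := p_step m u.
set X := onorm _ _ in h3 *; set Y := onorm _ _ in h1.
split; last by lra.
have X0 : 0 < X by lra.
have dom := p_pc_dominated m (W m.+1 *m u) (W m.+1 *m u).
rewrite -/X -/Y -/(A _ _) -/(D _ _) in dom.
have d0 : 0 <= delta by rewrite mulr_ge0.
have D'0 : 0 < D m.+1 u.
  rewrite lt_neqAle eq_sym D0 andbT; apply/negP => /eqP D'0.
  have A'0 : A m.+1 u <= 0 by rewrite -(pmulr_lle0 _ X0) (le_trans dom) // D'0 mul0r mulr0.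
  have /(onorm_eq0 (aU _)) : onorm (a m.+1) (W m.+1 *m u) <= 0.
    by apply: le_trans (AD _ _) _; rewrite D'0 addr0.
  move=> /(congr1 (mulmx (invmx (W m.+1)))); rewrite mulKmx ?WU // mulmx0 => u0.
  by rewrite /D u0 !mulmx0 onorm0 ltxx in h0.
rewrite -(ltr_pM2r X0) -mulrA.
have dY : delta * Y <= 3 / 2 * D m u.
  have : delta * Y <= delta * (A m u + K * theta * (A m u + D m u)).
    by rewrite ler_wpM2l.
  have : delta * (K * theta * (A m u + D m u)) <= 1 / 4 * (D m u / 2).
    have h4 : 0 <= K * theta * (A m u + D m u) by rewrite mulr_ge0 // addr_ge0.
    exact: ler_pM.
  rewrite mulrDr; lra.
have {}dom : delta * (A m.+1 u * X) <= D m.+1 u * (kappa * (delta * Y)).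
  apply: le_trans (ler_wpM2l d0 dom) _; apply: eq_ler; ring.
apply: le_lt_trans dom _; rewrite ltr_pM2l //.
have : kappa * (delta * Y) <= kappa * (3 / 2 * D m u) by rewrite ler_wpM2l.
have := ler_wpM2r (D0 m u) kappa8.
lra.
Qed.

Let outside m u : delta * A 0 u < D 0 u -> delta * A m u < D m u.
Proof. by elim: m => // m IH /IH /step []. Qed.

Let inside M l m : (m <= M)%N -> D M l <= delta * A M l ->
  D m l <= delta * A m l.
Proof.
move=> mM; rewrite -(subnK mM); elim: (M - m)%N => // j IH h; apply: IH.
rewrite leNgt; apply/negP => /step []; rewrite ltNge.
by rewrite addSn in h; rewrite h.
Qed.

(** Domination gives the factor 1/8 per step. Replacing [W m] by [W m.+1] loses at most a factor 2
    on the [pc] component of [u], which is outside the cone, and a factor 2 on the [p] component of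
    [l], which is inside: 1/2 remains. *)
Let growth M u l : delta * A 0 u < D 0 u -> D M l <= delta * A M l ->
  forall m, (m <= M)%N -> A m l * D 0 u <= 2^-1 ^+ m * (D m u * A 0 l).
Proof.
move=> hu hl; elim=> [_|m IH mM]; first by rewrite expr0 mul1r mulrC.
have := outside m hu => hm; have [_ hs] := step hm.
have hm0 : 0 < D m u by apply: le_lt_trans hm; rewrite mulr_ge0 // mulr_ge0.
have hin := inside (ltnW mM) hl.
have h1 := p_step m l.
have dom := p_pc_dominated m (W m.+1 *m l) (W m.+1 *m u).
rewrite -/(A _ _) -/(D _ _) in dom.
set Y := onorm (a m) (p *m _) in h1 dom; set X := onorm _ _ in hs dom.
have Y2 : Y <= 2 * A m l.
  have : K * theta * (A m l + D m l) <= 1 / 16 * (A m l + 1 / 4 * A m l).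
    apply: ler_pM => //; rewrite ?addr_ge0 //; first by have := Ktheta; lra.
    by rewrite lerD2l (le_trans hin) // ler_wpM2r // delta4.
  have := A0 m l; lra.
have s1 : A m.+1 l * D m u <= 2^-1 * (D m.+1 u * A m l).
  have : A m.+1 l * D m u <= A m.+1 l * (2 * X) by rewrite ler_wpM2l.
  have : kappa * (D m.+1 u * Y) <= 1 / 8 * (D m.+1 u * (2 * A m l)).
    apply: ler_pM => //; rewrite ?mulr_ge0 ?onorm_ge0 //; first by have := kappa8; lra.
    by rewrite ler_wpM2l.
  lra.
rewrite -(ler_pM2r hm0) mulrAC exprS.
have {}IH := IH (ltnW mM).
apply: le_trans (ler_wpM2r (D0 0 u) s1) _.
have i2 : 0 <= 2^-1 :> R by rewrite invr_ge0.
have := ler_wpM2l (mulr_ge0 i2 (D0 m.+1 u)) IH.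
lra.
Qed.

Variables (q qc : 'M[R]_n) (L Q : {vspace 'cV[R]_n}) (E K' : R).
Hypothesis qqc : q + qc = 1%:M.
Hypothesis pL : forall u, u \in L -> p *m u = u.
Hypothesis qQ : forall u, u \in Q -> q *m u = 0.
Hypothesis dimLQ : (\dim L + \dim Q)%N = n.
Hypothesis E0 : 0 <= E.
Hypothesis qcK : forall m u,
  onorm (a m) (W m *m (qc *m u)) <= K' * onorm (a m) (W m *m u).
Hypothesis q_qc_dominated : forall m u v,
  onorm (a m) (W m *m (q *m u)) * onorm (a 0) (W 0 *m (qc *m v)) <=
  E * (onorm (a m) (W m *m (qc *m v)) * onorm (a 0) (W 0 *m (q *m u))).

Let pcL u : u \in L -> pc *m u = 0.
Proof. by move=> /pL pu; rewrite -[pc *m u](addKr (p *m u)) -mulmxDl ppc mul1mx pu addNr. Qed.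

(** The preimage of [L] under [W M] has the dimension of [L], and the sum of [Q] and the line of [u]
    has dimension \dim Q + 1, because [q] kills [Q] and fixes [u]. The two dimensions add up to n +
    1. *)
Let exists_meet M u : q *m u = u -> u != 0 ->
  exists l c, [/\ l != 0, W M *m l \in L & q *m l = c *: u].
Proof.
move=> qu u0.
pose f : 'End('cV[R]_n) := linfun (mulmx (invmx (W M))).
have fE v : f v = invmx (W M) *m v by rewrite lfunE.
have dimf : \dim (f @: L) = \dim L.
  apply: limg_dim_eq; apply/eqP; rewrite -subv0; apply/subvP => v.
  rewrite memv_cap memv_ker fE => /andP[_ /eqP v0].
  by rewrite memv0 -(mulKVmx (WU M) v) v0 mulmx0.
have uQ : (<[u]> :&: Q = 0)%VS.
  apply/eqP; rewrite -subv0; apply/subvP => v; rewrite memv_cap memv0.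
  move=> /andP[/vlineP[c ->] cuQ].
  by have := qQ cuQ; rewrite -scalemxAr qu => /eqP.
have dimUQ : \dim (<[u]> + Q) = (\dim Q).+1.
  have := dimv_disjoint_sum uQ; rewrite dim_vline u0 add1n; exact.
have : (0 < \dim (f @: L :&: (<[u]> + Q)))%N.
  rewrite lt0n; apply/negP => /eqP h.
  have := dimv_sum_cap (f @: L) (<[u]> + Q); rewrite h addn0 dimf dimUQ addnS dimLQ.
  move=> h'; have := dimvS (subvf (f @: L + (<[u]> + Q))%VS); rewrite h'.
  by rewrite dimvf /dim /= muln1 ltnn.
rewrite lt0n dimv_eq0 => /eqP h.
have /eqP := h.
set S := (f @: L :&: (<[u]> + Q))%VS in h *.
move=> S0; have [lS l0] : vpick S \in S /\ vpick S != 0.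
  by rewrite memv_pick vpick0.
move: lS; rewrite memv_cap => /andP[/memv_imgP[v vL le] /memv_addP[u1 /vlineP[c ->] [v1 v1Q le']]].
exists (vpick S), c; split => //.
  by rewrite le fE mulKVmx ?WU.
by rewrite le' mulmxDr (qQ v1Q) addr0 -scalemxAr qu.
Qed.

(* Suppose that [u] is in the range of [q] but outside the cone. By a dimension
   count some nonzero [l] satisfies [W M *m l \in L] and [q *m l = c *: u]. Then
   [l] is in the cone up to time [M], hence grows less than [u], so it cannot be
   close to the line of [u] at time 0: its component along the range of [qc] is
   not small there, and therefore [l] grows more than [u] for large [M]. *)
Lemma invariant_subspace_in_cone u : q *m u = u ->
  onorm (a 0) (pc *m (W 0 *m u)) <=
    2 * (4 * (K * theta)) * onorm (a 0) (p *m (W 0 *m u)).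
Proof.
move=> qu; rewrite -/delta -/(A 0 u) -/(D 0 u) leNgt; apply/negP => hu.
have u0 : u != 0.
  by apply: contraTneq hu => ->; rewrite /A /D !mulmx0 onorm0 mulr0 ltxx.
have Kp : 0 < K.
  rewrite lt_neqAle K0 andbT eq_sym; apply/negP => /eqP Ke.
  have := pcK 0 (W 0 *m u); rewrite Ke mul0r leNgt => /negP; apply.
  by apply: le_lt_trans hu; rewrite mulr_ge0 // mulr_ge0 // mulr_ge0.
have d0 : 0 < delta by rewrite /delta !mulr_gt0.
have hu1 : delta * A 0 u < D 0 u.
  by apply: le_lt_trans hu; apply: ler_wpM2r => //; lra.
(* If the [qc] component of [l] were shorter than [c] times [l], it would change [A] and [D] by at
   most [delta / 16 * (A + D)]. This is too little to bring a multiple of [u], for which D > 2 delta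
   A, into the cone D <= delta A: the factor 2 in the statement provides this gap. *)
pose c : R := delta / (16 * K).
have c0 : 0 < c by rewrite divr_gt0 // mulr_gt0.
(* The left side does not depend on [M]. The uncontrolled constants [E] and [K'] of the perturbed
   splitting occur only in front of [2^-1 ^+ M]. *)
have key M : c * D 0 u <= 2^-1 ^+ M * (K * K * E * K' * onorm (a 0) (W 0 *m u)).
  have [l [r [l0 WlL qlu]]] := exists_meet M qu u0.
  have hl : D M l <= delta * A M l.
    by rewrite /D pcL // onorm0 mulr_ge0 // ltW.
  have AMl : A M l = onorm (a M) (W M *m l) by rewrite /A pL.
  have Wl0 m : 0 < onorm (a m) (W m *m l).
    rewrite onorm_gt0 //; apply: contra l0 => /eqP h.
    by rewrite -(mulKmx (WU m) l) h mulmx0.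
  have hl0 := inside (leq0n M) hl.
  have far : c * onorm (a 0) (W 0 *m l) <= onorm (a 0) (W 0 *m (qc *m l)).
    rewrite leNgt; apply/negP => close.
    have lE : l = r *: u + qc *m l by rewrite -qlu -mulmxDl qqc mul1mx.
    have WlE (c' : 'M[R]_n) : c' *m (W 0 *m l) =
        r *: (c' *m (W 0 *m u)) + c' *m (W 0 *m (qc *m l)).
      by rewrite {1}lE !mulmxDr -!scalemxAr.
    have Al : A 0 l <= `|r| * A 0 u + K * onorm (a 0) (W 0 *m (qc *m l)).
      rewrite {1}/A WlE -onormZ.
      by rewrite (le_trans (ler_onormD _ _ _)) // lerD2l.
    have Dl : `|r| * D 0 u - K * onorm (a 0) (W 0 *m (qc *m l)) <= D 0 l.
      rewrite {2}/D WlE -onormZ.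
      apply: le_trans (lerB_onorm _ _ _); rewrite lerD2l lerN2; exact: pcK.
    have hr : 2 * delta * (`|r| * A 0 u) <= `|r| * D 0 u.
      by rewrite mulrCA ler_wpM2l // ltW.
    have Kc : K * (c * onorm (a 0) (W 0 *m l)) <= delta / 16 * (A 0 l + D 0 l).
      have -> : K * (c * onorm (a 0) (W 0 *m l)) = delta / 16 * onorm (a 0) (W 0 *m l).
        by rewrite /c; field; rewrite gt_eqF.
      by rewrite ler_wpM2l ?AD // divr_ge0 // ltW.
    have Kclose : K * onorm (a 0) (W 0 *m (qc *m l)) <
        K * (c * onorm (a 0) (W 0 *m l)) by rewrite ltr_pM2l.
    have d4 := delta4.
    have ADl : 0 < A 0 l + D 0 l by apply: lt_le_trans (Wl0 0%N) (AD _ _).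
    set Z := K * onorm _ _ in Kclose Al Dl.
    have : delta * Z <= delta / 4 * (A 0 l + D 0 l) / 16.
      have : delta * Z <= 1 / 4 * (delta / 16 * (A 0 l + D 0 l)).
        apply: ler_pM; rewrite ?(ltW d0) //; first by rewrite mulr_ge0 // onorm_ge0.
        by apply: le_trans (ltW Kclose) Kc.
      lra.
    have dAl : 2 * delta * A 0 l <= 2 * delta * (`|r| * A 0 u + Z).
      by rewrite ler_wpM2l // mulr_ge0 // ltW.
    have dD : delta * D 0 l <= 1 / 4 * (delta * A 0 l) by apply: ler_pM; rewrite // ltW.
    have Al0 : 0 < A 0 l.
      rewrite lt_neqAle A0 andbT eq_sym; apply/negP => /eqP Al0.
      by move: ADl hl0; rewrite Al0 mulr0 add0r ltNge => /negP.
    have := mulr_gt0 d0 Al0; lra.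
  have gr := growth hu1 hl (leqnn M).
  have dom := q_qc_dominated M u l; rewrite qu in dom.
  have qcl := qcK M l.
  rewrite AMl in gr.
  have Dle := pcK M (W M *m u); rewrite -/(D _ _) in Dle.
  have Ale := pK 0 (W 0 *m l); rewrite -/(A _ _) in Ale.
  have e0 : 0 <= 2^-1 ^+ M :> R by rewrite exprn_ge0 // invr_ge0.
  rewrite -(ler_pM2r (mulr_gt0 (Wl0 M) (Wl0 0%N))).
  set x := onorm (a M) (W M *m l) in gr qcl *; set y := onorm (a 0) (W 0 *m l) in far Ale *.
  set nu := onorm (a M) (W M *m u) in dom Dle.
  set nu0 := onorm (a 0) (W 0 *m u) in dom *.
  have y0 : 0 <= y by exact: onorm_ge0.
  have x0 : 0 <= x by exact: onorm_ge0.
  have nu_ge0 : 0 <= nu by exact: onorm_ge0.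
  have nu0_ge0 : 0 <= nu0 by exact: onorm_ge0.
  have s1 : x * D 0 u <= 2^-1 ^+ M * (K * nu * (K * y)).
    apply: le_trans gr _; rewrite ler_wpM2l //; apply: ler_pM => //.
  have s2 : nu * (c * y) <= E * (K' * x * nu0).
    apply: le_trans (ler_wpM2l nu_ge0 far) _; apply: le_trans dom _.
    by rewrite ler_wpM2l // ler_wpM2r.
  have cy0 : 0 <= c * y by rewrite mulr_ge0 // ltW.
  have s3 := ler_wpM2r cy0 s1.
  have K2 : 0 <= 2^-1 ^+ M * (K * K * y) by rewrite !mulr_ge0.
  have s4 := ler_wpM2l K2 s2.
  apply: le_trans (_ : _ <= x * D 0 u * (c * y)) _.
    by apply: eq_ler; ring.
  apply: le_trans s3 _.
  apply: le_trans (_ : _ <= 2^-1 ^+ M * (K * K * y) * (nu * (c * y))) _.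
    by apply: eq_ler; ring.
  apply: le_trans s4 _.
  by apply: eq_ler; ring.
have cD : 0 < c * D 0 u.
  by rewrite mulr_gt0 // (le_lt_trans _ hu1) // mulr_ge0 // ltW.
set C := K * K * E * K' * _ in key.
have lim0 : 2^-1 ^+ M * C @[M --> \oo] --> (0 : R).
  rewrite -[X in _ --> X](mul0r C); apply: cvgM; last exact: cvg_cst.
  by apply: cvg_expr; rewrite ger0_norm ?invr_ge0 // invf_lt1 // ltr1n.
have : c * D 0 u <= 0.
  apply: (ler_cvg_to (cvg_cst _) lim0); exact: nearW.
by rewrite leNgt cD.
Qed.

End ConeField.

(** * Matrix-valued functions of a real variable *)

Section MatrixLimits.
Context {R : realType}.

Lemma cvg_mxP {T : Type} {F : set_system T} {FF : Filter F} m n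
    (f : T -> 'M[R]_(m, n)) (l : 'M[R]_(m, n)) :
  f x @[x --> F] --> l <-> forall i j, f x i j @[x --> F] --> l i j.
Proof.
split=> [fl i j|fl].
  apply/cvgrPdist_le => e e0; move/cvgrPdist_le : fl => /(_ _ e0).
  apply: filterS => x; apply: le_trans.
  rewrite [leRHS]/Num.Def.normr /= mx_normrE.
  apply: le_trans; last exact: (le_bigmax _ _ (i, j)).
  by rewrite !mxE.
apply/cvgrPdist_le => e e0.
have H : \forall x \near F, forall ij : 'I_m * 'I_n, `|l ij.1 ij.2 - f x ij.1 ij.2| <= e.
  by apply: filter_forall => ij; move/cvgrPdist_le : (fl ij.1 ij.2); apply.
apply: filterS H => x H.
rewrite [leLHS]/Num.Def.normr /= mx_normrE (bigmax_le _ (ltW e0)) //= => ij _.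
by rewrite !mxE.
Qed.

Lemma cvg_mulmx {T : Type} {F : set_system T} {FF : Filter F} m n k
    (f : T -> 'M[R]_(m, n)) (g : T -> 'M[R]_(n, k)) (a : 'M[R]_(m, n)) (b : 'M[R]_(n, k)) :
  f x @[x --> F] --> a -> g x @[x --> F] --> b ->
  f x *m g x @[x --> F] --> a *m b.
Proof.
move=> /cvg_mxP fa /cvg_mxP gb; apply/cvg_mxP => i j.
rewrite mxE.
have -> : (fun x => (f x *m g x) i j) = fun x => \sum_l f x i l * g x l j.
  by apply/funext => x; rewrite mxE.
apply: cvg_big => [|l _]; last exact: cvgM.
exact: add_continuous.
Qed.

Lemma is_derive1P {W : normedModType R} (f : R -> W) x D :
  is_derive x (1 : R) f D <->
  h^-1 *: (f (x + h) - f x) @[h --> (0 : R)^'] --> D.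
Proof.
have E : (fun h : R => h^-1 *: ((f \o shift x) (h *: (1 : R)) - f x)) =
    (fun h => h^-1 *: (f (x + h) - f x)).
  by apply/funext => h /=; rewrite [h%:A](mulr1) [h + x]addrC.
split=> [[dv <-]|h].
  move: dv; rewrite /derivable /derive E; exact.
have dv : derivable f x 1 by rewrite /derivable E; apply/cvg_ex; exists D.
apply: DeriveDef => //; rewrite /derive E; exact: cvg_lim.
Qed.

Lemma is_derive_mxP m n (f : R -> 'M[R]_(m, n)) x D :
  is_derive x (1 : R) f D <->
  forall i j, is_derive x (1 : R) (fun t => f t i j) (D i j).
Proof.
split=> [/is_derive1P /cvg_mxP H i j|H].
  apply/is_derive1P; move: (H i j); apply: cvg_trans; apply: near_eq_cvg.
  by apply: nearW => h; rewrite !mxE.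
apply/is_derive1P/cvg_mxP => i j.
move/is_derive1P : (H i j); apply: cvg_trans; apply: near_eq_cvg.
by apply: nearW => h; rewrite !mxE.
Qed.

Lemma is_derive_suml n (h : 'I_n -> R -> R) x dh :
  (forall i, is_derive x (1 : R) (h i) (dh i)) ->
  is_derive x (1 : R) (fun t => \sum_i h i t) (\sum_i dh i).
Proof.
move=> H; have -> : (fun t => \sum_i h i t) = \sum_i h i.
  by apply/funext => t; rewrite fct_sumE.
exact: is_derive_sum.
Qed.

Lemma is_derive_mul (f g : R -> R) x df dg :
  is_derive x (1 : R) f df -> is_derive x (1 : R) g dg ->
  is_derive x (1 : R) (fun t => f t * g t) (df * g x + f x * dg).
Proof.
move=> Hf Hg; have H := is_deriveM Hf Hg.
by apply: is_derive_eq; rewrite addrC /GRing.scale /= [g x * _]mulrC.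
Qed.

Lemma is_derive_mulmx m n k (f : R -> 'M[R]_(m, n)) (g : R -> 'M[R]_(n, k)) x df dg :
  is_derive x (1 : R) f df -> is_derive x (1 : R) g dg ->
  is_derive x (1 : R) (fun t => f t *m g t) (df *m g x + f x *m dg).
Proof.
move=> /is_derive_mxP Hf /is_derive_mxP Hg; apply/is_derive_mxP => i j.
have -> : (fun t => (f t *m g t) i j) = fun t => \sum_l f t i l * g t l j.
  by apply/funext => t; rewrite mxE.
have -> : (df *m g x + f x *m dg) i j =
    \sum_l (df i l * g x l j + f x i l * dg l j).
  by rewrite !mxE -big_split.
by apply: is_derive_suml => l; apply: is_derive_mul.
Qed.

Lemma is_derive_mulmxl m n k (c : 'M[R]_(m, n)) (g : R -> 'M[R]_(n, k)) x dg :
  is_derive x (1 : R) g dg ->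
  is_derive x (1 : R) (fun t => c *m g t) (c *m dg).
Proof.
move=> Hg; have := is_derive_mulmx (is_derive_cst c x 1) Hg.
by rewrite mul0mx add0r.
Qed.

Lemma is_derive_mulmxr m n k (f : R -> 'M[R]_(m, n)) (c : 'M[R]_(n, k)) x df :
  is_derive x (1 : R) f df ->
  is_derive x (1 : R) (fun t => f t *m c) (df *m c).
Proof.
move=> Hf; have := is_derive_mulmx Hf (is_derive_cst c x 1).
by rewrite mulmx0 addr0.
Qed.

Lemma is_derive_trmx m n (f : R -> 'M[R]_(m, n)) x df :
  is_derive x (1 : R) f df -> is_derive x (1 : R) (fun t => (f t)^T) df^T.
Proof.
move=> /is_derive_mxP Hf; apply/is_derive_mxP => i j; rewrite mxE.
have -> : (fun t => (f t)^T i j) = fun t => f t j i.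
  by apply/funext => t; rewrite mxE.
exact: Hf.
Qed.

Lemma is_derive_affine m n (f : R -> 'M[R]_(m, n)) (r k x : R) df :
  is_derive (r + x * k) (1 : R) f df ->
  is_derive x (1 : R) (fun t => f (r + t * k)) (k *: df).
Proof.
move=> /is_derive_mxP Hf; apply/is_derive_mxP => i j; rewrite mxE.
have Hg : is_derive x (1 : R) (fun t => r + t * k) k.
  have H := is_derive_mul (is_derive_id x (1 : R)) (is_derive_cst k x (1 : R)).
  have H2 := is_deriveD (is_derive_cst r x (1 : R)) H.
  by apply: is_derive_eq; rewrite /= add0r mul1r mulr0 addr0.
rewrite mulrC.
exact: (@is_derive1_comp _ (fun t => f t i j) (fun t => r + t * k) x _ _ (Hf i j) Hg).
Qed.

Lemma is_derive_edot n (u v : R -> 'cV[R]_n) x du dv :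
  is_derive x (1 : R) u du -> is_derive x (1 : R) v dv ->
  is_derive x (1 : R) (fun t => edot (u t) (v t)) (edot du (v x) + edot (u x) dv).
Proof.
move=> /is_derive_mxP Hu /is_derive_mxP Hv.
rewrite /edot -big_split.
by apply: is_derive_suml => i; apply: is_derive_mul.
Qed.

Lemma mean_value (f df : R -> R) (a b : R) : a <= b ->
  (forall x, x \in `[a, b] -> is_derive x (1 : R) f (df x)) ->
  exists2 c, c \in `[a, b] & f b - f a = df c * (b - a).
Proof.
move=> ab fdf.
have H x : x \in `]a, b[ -> is_derive x (1 : R) f (df x).
  by move=> h; apply: fdf; exact: subset_itv_oo_cc.
have H2 : {within `[a, b], continuous f}.
  apply: derivable_within_continuous => x xab.
  by have [] := fdf x xab.
exact: (@MVT_segment R f df a b ab H H2).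
Qed.

End MatrixLimits.

(** * Gronwall estimates for linear equations *)

Section Gronwall.
Context {R : realType} {n : nat}.

Lemma gronwall_unit_interval (v : R -> 'cV[R]_n) (Q : R -> 'M[R]_n) (c : R) :
  (forall s, is_derive s (1 : R) v (Q s *m v s)) -> 0 <= c -> 4 * c <= 1 ->
  (forall s u, 0 <= s <= 1 -> enorm (Q s *m u) <= c * enorm u) ->
  enorm (v 1 - v 0) <= 2 * c * enorm (v 0).
Proof.
move=> vQ c0 c4 Qc.
(* |v s|^2 (1 - 2 c s) is nonincreasing on [0, 1]. *)
have vle s : 0 <= s <= 1 -> enorm (v s) <= 2 * enorm (v 0).
  move=> /andP[s0 s1].
  have df t : is_derive t (1 : R) (fun t => edot (v t) (v t) * (1 - 2 * c * t))
      ((edot (Q t *m v t) (v t) + edot (v t) (Q t *m v t)) * (1 - 2 * c * t)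
        + edot (v t) (v t) * (- (2 * c))).
    apply: is_derive_mul; first exact: is_derive_edot.
    have H := is_deriveB (is_derive_cst (1 : R) t (1 : R))
      (is_derive_mul (is_derive_cst (2 * c) t (1 : R)) (is_derive_id t (1 : R))).
    by apply: is_derive_eq; rewrite mul0r mulr1 !add0r.
  have [t] := mean_value s0 (fun t _ => df t).
  rewrite in_itv /= subr0 mulr0 subr0 mulr1 => /andP[t0 ts] fE.
  have t1 : t <= 1 by apply: le_trans s1.
  have cI z : 0 <= z -> z <= 1 -> 0 <= c * z /\ c * z <= 1 / 4.
    move=> z0 z1; split; first exact: mulr_ge0.
    by apply: le_trans (ler_piMr c0 z1) _; lra.
  have [ct0 ct4] := cI _ t0 t1; have [cs0 cs4] := cI _ s0 s1.
  have vQv : edot (v t) (Q t *m v t) <= c * edot (v t) (v t).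
    apply: le_trans (ler_norm _) _; apply: le_trans (edot_le _ _) _.
    rewrite -enorm2 expr2 mulrCA ler_wpM2l ?enorm_ge0 // Qc //; exact/andP.
  have vv0 := edot_ge0 (v t).
  have fle : edot (v s) (v s) * (1 - 2 * c * s) <= edot (v 0) (v 0).
    rewrite -subr_le0 fE; apply: mulr_le0_ge0 => //.
    rewrite (edotC (Q t *m v t)).
    set x := edot _ (Q t *m _) in vQv *; set y := edot _ _ in vv0 vQv *.
    have : 2 * x * (1 - 2 * c * t) <= 2 * (c * y) * (1 - 2 * c * t).
      by apply: ler_wpM2r; lra.
    have : 0 <= c * y * (c * t) by rewrite !mulr_ge0.
    move: vQv fE => _ _; lra.
  have vs0 := edot_ge0 (v s).
  rewrite -(@ler_pXn2r _ 2) ?nnegrE ?mulr_ge0 ?enorm_ge0 // exprMn !enorm2.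
  have : edot (v s) (v s) * (1 / 2) <= edot (v s) (v s) * (1 - 2 * c * s).
    by apply: ler_wpM2l => //; lra.
  have := edot_ge0 (v 0); rewrite expr2; lra.
set z := v 1 - v 0.
have [z0|zn0] := eqVneq (enorm z) 0.
  by rewrite z0 !mulr_ge0 // enorm_ge0.
have zgt0 : 0 < enorm z by rewrite lt_neqAle eq_sym zn0 enorm_ge0.
(* A mean value equality requires a scalar function: [v] is paired with its own increment [z]. *)
have df t : is_derive t (1 : R) (fun t => edot (v t) z) (edot (Q t *m v t) z).
  have := is_derive_edot (vQ t) (is_derive_cst z t (1 : R)).
  by rewrite /= edot0r addr0.
have [t tI] := mean_value ler01 (fun t _ => df t).
rewrite -edotBl -/z -enorm2 subr0 mulr1 => zE.
rewrite -(ler_pM2r zgt0) -expr2 zE.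
apply: le_trans (ler_norm _) _; apply: le_trans (edot_le _ _) _.
rewrite ler_wpM2r ?enorm_ge0 //.
have t01 : 0 <= t <= 1 by move: tI; rewrite in_itv.
apply: le_trans (Qc _ _ t01) _.
by rewrite (mulrC 2) -mulrA ler_wpM2l // vle.
Qed.

(** Conjugating by [a] makes the norm Euclidean, and the segment from [r] to [t] is reparametrized
    by [0, 1]. The resulting equation Y' = Y M has the coefficient on the right, so the Gronwall
    estimate is applied to the transpose. *)
Lemma transport_close (G B : R -> 'M[R]_n) (a : 'M[R]_n) (r t c : R) :
  a \in unitmx -> G r \in unitmx ->
  (forall s, is_derive s (1 : R) G (G s *m B s)) ->
  0 <= c -> 4 * (c * `|t - r|) <= 1 ->
  (forall s u, `|s - r| <= `|t - r| -> onorm a (B s *m u) <= c * onorm a u) ->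
  forall u, onorm a (invmx (G r) *m G t *m u - u) <= 2 * (c * `|t - r|) * onorm a u.
Proof.
move=> aU GU GB c0 ctr Bc u.
pose b := a *m invmx (G r).
pose Y s := b *m G (r + s * (t - r)) *m invmx a.
pose M s := (t - r) *: (a *m B (r + s * (t - r)) *m invmx a).
have YM s : is_derive s (1 : R) Y (Y s *m M s).
  rewrite /M -scalemxAr.
  have -> : Y s *m (a *m B (r + s * (t - r)) *m invmx a) =
      b *m (G (r + s * (t - r)) *m B (r + s * (t - r))) *m invmx a.
    by rewrite /Y !mulmxA mulmxKV.
  rewrite scalemxAl scalemxAr; apply: is_derive_mulmxr; apply: is_derive_mulmxl.
  exact: is_derive_affine.
have Mc s w : 0 <= s <= 1 -> enorm (M s *m w) <= c * `|t - r| * enorm w.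
  move=> /andP[s0 s1]; rewrite /M -scalemxAl enormZ -!mulmxA.
  rewrite (mulrC c) -mulrA ler_wpM2l //.
  have := @Bc (r + s * (t - r)) (invmx a *m w).
  rewrite /onorm mulKVmx //; apply.
  by rewrite addrAC subrr add0r normrM (ger0_norm s0) ler_piMl.
have Y0 : Y 0 = 1%:M.
  by rewrite /Y mul0r addr0 /b mulmxKV // mulmxV.
have Y1 : Y 1 = a *m (invmx (G r) *m G t) *m invmx a.
  by rewrite /Y mul1r addrCA subrr addr0 /b !mulmxA.
have YT w : enorm ((Y 1 - 1%:M)^T *m w) <= 2 * (c * `|t - r|) * enorm w.
  have dv s : is_derive s (1 : R) (fun s => (Y s)^T *m w) ((M s)^T *m ((Y s)^T *m w)).
    rewrite mulmxA -trmx_mul; apply: is_derive_mulmxr; exact: is_derive_trmx.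
  have := gronwall_unit_interval dv (mulr_ge0 c0 (normr_ge0 _)) ctr.
  rewrite Y0 trmx1 mul1mx linearB /= trmx1 mulmxBl mul1mx; apply=> s z s01.
  by apply: enorm_trmx => {}z; apply: Mc.
have := enorm_trmx YT (a *m u).
rewrite trmxK Y1 mulmxBl mul1mx -!mulmxA mulKmx //.
by rewrite /onorm mulmxBr.
Qed.

End Gronwall.

(** * Perturbation of a dominated projector along one orbit *)

Section Orbit.
Context {R : realType} {n : nat}.
Implicit Types (a G : R -> 'M[R]_n) (p q : 'M[R]_n).

(* [a s] sends the frame at time [s] to the standard basis, in a trivialization
   where the flow acts as the identity. *)
Definition dominated_orbit a p (pc : 'M[R]_n) (B b : R) : Prop :=
  forall r s u v, r <= s ->
    onorm (a s) (p *m u) * onorm (a r) (pc *m v) <=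
    B * expR (- (b * (s - r))) *
      (onorm (a s) (pc *m v) * onorm (a r) (p *m u)).

(** The scalar [c] depends on the two times but not on the vector. Hence a bound on an operator
    passes from one time to the other at the cost of [K ^+ 2], however much the norms themselves
    grow. *)
Definition comparable_orbit a (T K : R) : Prop :=
  forall r s, `|s - r| <= T -> exists2 c : R, 0 < c &
    forall u, onorm (a s) u <= K * (c * onorm (a r) u) /\
              c * onorm (a r) u <= K * onorm (a s) u.

Lemma dominated_orbit_rev a p pc B b : dominated_orbit a p pc B b ->
  dominated_orbit (fun s => a (- s)) pc p B b.
Proof.
move=> H r s u v rs.
have := H (- s) (- r) v u; rewrite lerN2 => /(_ rs).
by rewrite opprK (addrC (- r)) ![onorm (a (- s)) _ * _]mulrC.
Qed.

Lemma comparable_orbit_rev a T K : comparable_orbit a T K ->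
  comparable_orbit (fun s => a (- s)) T K.
Proof.
move=> H r s rs; apply: H.
by rewrite -normrN opprB opprK addrC.
Qed.

(** The orbit is sampled with step [T], long enough for domination to contract by 1/8. Over one step
    [invmx (G s)] moves by a relative amount [2 * (K2 ^+ 2 * eta * T)], where [K2 ^+ 2] is the cost
    of measuring [Bt] at neighbouring times in the norm of the sampling time. *)
Lemma orbit_cone a G (Bt : R -> 'M[R]_n) p pc q qc (L Q : {vspace 'cV[R]_n})
    (K B b T K2 eta K' B' b' : R) :
  (forall s, a s \in unitmx) -> (forall s, G s \in unitmx) ->
  p + pc = 1%:M -> 1 <= K ->
  (forall s u, onorm (a s) (p *m u) <= K * onorm (a s) u) ->
  (forall s u, onorm (a s) (pc *m u) <= K * onorm (a s) u) ->
  0 <= B -> dominated_orbit a p pc B b ->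
  0 < T -> 8 * (B * expR (- (b * T))) <= 1 ->
  0 < K2 -> comparable_orbit a (2 * T) K2 ->
  (forall s, is_derive s (1 : R) G (G s *m Bt s)) ->
  0 < eta -> (forall s u, onorm (a s) (Bt s *m u) <= eta * onorm (a s) u) ->
  16 * (K * (2 * (K2 ^+ 2 * eta * T))) <= 1 ->
  q + qc = 1%:M ->
  (forall u, u \in L -> p *m u = u) -> (forall u, u \in Q -> q *m u = 0) ->
  (\dim L + \dim Q)%N = n ->
  0 <= B' -> 0 <= b' ->
  (forall s u, onorm (a s *m invmx (G s)) (qc *m u) <=
     K' * onorm (a s *m invmx (G s)) u) ->
  dominated_orbit (fun s => a s *m invmx (G s)) q qc B' b' ->
  forall u, q *m u = u ->
    onorm (a 0) (pc *m (invmx (G 0) *m u)) <=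
    8 * (K * (2 * (K2 ^+ 2 * eta * T))) * onorm (a 0) (p *m (invmx (G 0) *m u)).
Proof.
move=> aU GU ppc K1 pK pcK B0 dom T0 BT K20 comp GB eta0 Bteta small qqc pL qQ dLQ
  B'0 b'0 qcK qdom u qu.
have onE s w : onorm (a s *m invmx (G s)) w = onorm (a s) (invmx (G s) *m w).
  by rewrite /onorm mulmxA.
pose th := 2 * (K2 ^+ 2 * eta * T).
have th0 : 0 < th by rewrite !mulr_gt0 // exprn_gt0.
have K0 : 0 <= K by apply: le_trans K1.
have th4 : 4 * (K2 ^+ 2 * eta * T) <= 1.
  have : th <= K * th by rewrite ler_peMl // ltW.
  by rewrite -/th in small; rewrite /th in small *; lra.
have step m w : onorm (a (m%:R * T)) (invmx (G (m.+1%:R * T)) *m w - invmx (G (m%:R * T)) *m w)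
    <= th * onorm (a (m%:R * T)) (invmx (G (m%:R * T)) *m w).
  have dT : `|m%:R * T - m.+1%:R * T| = T.
    by rewrite -mulrBl -[m.+1]addn1 natrD opprD addNKr mulN1r normrN gtr0_norm.
  have c0 : 0 <= K2 ^+ 2 * eta by rewrite mulr_ge0 ?sqr_ge0 // ltW.
  have := @transport_close R n G Bt (a (m%:R * T)) (m.+1%:R * T) (m%:R * T)
    (K2 ^+ 2 * eta) (aU _) (GU _) GB c0.
  rewrite dT => /(_ th4) H.
  have /H{}H : forall s v, `|s - m.+1%:R * T| <= T ->
      onorm (a (m%:R * T)) (Bt s *m v) <= K2 ^+ 2 * eta * onorm (a (m%:R * T)) v.
    move=> s v sT.
    (* The transport estimate is based at (m + 1) T and asks for [Bt] at all times within T of it,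
       hence up to 2 T away from m T. *)
    have : `|s - m%:R * T| <= 2 * T.
      have -> : s - m%:R * T = (s - m.+1%:R * T) + (m.+1%:R * T - m%:R * T).
        by rewrite addrA subrK.
      by apply: le_trans (ler_normD _ _) _; rewrite [X in _ + X]distrC dT; lra.
    move=> /comp [c cpos cc]; have [_ c1] := cc (Bt s *m v); have [c2 _] := cc v.
    rewrite -(ler_pM2l cpos); apply: le_trans c1 _.
    apply: le_trans (ler_wpM2l (ltW K20) (Bteta s v)) _.
    have := ler_wpM2l (ltW (mulr_gt0 K20 eta0)) c2; rewrite expr2; lra.
  have := H (invmx (G (m%:R * T)) *m w).
  by rewrite -(mulmxA _ (G _)) mulKVmx // /th.
suff : onorm (a (0%:R * T)) (pc *m (invmx (G (0%:R * T)) *m u)) <=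
    2 * (4 * (K * th)) * onorm (a (0%:R * T)) (p *m (invmx (G (0%:R * T)) *m u)).
  by rewrite mul0r (_ : 2 * (4 * (K * th)) = 8 * (K * th)) //; ring.
apply: (@invariant_subspace_in_cone R n (fun m => a (m%:R * T))
  (fun m => invmx (G (m%:R * T))) p pc K (B * expR (- (b * T))) th
  _ _ ppc K0 _ _ _ _ BT th0 small step q qc L Q B' K' qqc pL qQ dLQ B'0 _ _ u qu).
- by move=> m.
- by move=> m; rewrite unitmx_inv.
- by move=> m.
- by move=> m.
- move=> m w v; have /(dom _ _ w v) : m%:R * T <= m.+1%:R * T.
    by rewrite ler_wpM2r ?ler_nat // ltW.
  by rewrite -mulrBl -[m.+1]addn1 natrD addrAC subrr add0r mul1r.
- by rewrite mulr_ge0 // expR_ge0.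
- by move=> m w; have := qcK (m%:R * T) w; rewrite !onE.
- move=> m w v; have /(qdom _ _ w v) : 0 <= m%:R * T by rewrite mulr_ge0 // ltW.
  rewrite !onE mul0r subr0 => /le_trans; apply.
  rewrite ler_wpM2r ?mulr_ge0 ?onorm_ge0 // ler_piMr // -expR0 ler_expR oppr_le0.
  by rewrite !mulr_ge0 // ltW.
Qed.

(** The cone estimate is used twice: for the range of [q], and in reversed time for its kernel,
    where [p] and its complement are exchanged. If x and y are the components of [u] in the
    conjugated range and kernel, the difference of the projectors sends [u] to [pc *m x - p *m y],
    and each cone estimate bounds one of the two terms. *)
Lemma orbit_projector_close a G (Bt : R -> 'M[R]_n) p q
    (L0 P0 Lt Pt : {vspace 'cV[R]_n}) (K B b T K2 eta K' B' b' : R) :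
  (forall s, a s \in unitmx) -> (forall s, G s \in unitmx) ->
  1 <= K ->
  (forall s u, onorm (a s) (p *m u) <= K * onorm (a s) u) ->
  (forall s u, onorm (a s) ((1%:M - p) *m u) <= K * onorm (a s) u) ->
  0 <= B -> dominated_orbit a p (1%:M - p) B b ->
  0 < T -> 8 * (B * expR (- (b * T))) <= 1 ->
  0 < K2 -> comparable_orbit a (2 * T) K2 ->
  (forall s, is_derive s (1 : R) G (G s *m Bt s)) ->
  0 < eta -> (forall s u, onorm (a s) (Bt s *m u) <= eta * onorm (a s) u) ->
  16 * (K * (2 * (K2 ^+ 2 * eta * T))) <= 1 ->
  q *m q = q ->
  (forall u, u \in L0 -> p *m u = u) -> (forall u, u \in P0 -> p *m u = 0) ->
  (forall u, u \in Lt -> q *m u = u) -> (forall u, u \in Pt -> q *m u = 0) ->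
  (\dim L0 + \dim Pt)%N = n -> (\dim P0 + \dim Lt)%N = n ->
  0 <= B' -> 0 <= b' ->
  (forall s u, onorm (a s *m invmx (G s)) (q *m u) <=
     K' * onorm (a s *m invmx (G s)) u) ->
  (forall s u, onorm (a s *m invmx (G s)) ((1%:M - q) *m u) <=
     K' * onorm (a s *m invmx (G s)) u) ->
  dominated_orbit (fun s => a s *m invmx (G s)) q (1%:M - q) B' b' ->
  forall u, onorm (a 0) ((invmx (G 0) *m q *m G 0 - p) *m u) <=
    32 * K * (K * (2 * (K2 ^+ 2 * eta * T))) * onorm (a 0) u.
Proof.
move=> aU GU K1 pK pcK B0 dom T0 BT K20 comp GB eta0 Bteta small qq pL0 pP0
  qLt qPt d1 d2 B'0 b'0 qK qcK qdom u.
set pc := 1%:M - p in pcK dom; set qc := 1%:M - q in qcK qdom.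
have ppc : p + pc = 1%:M by rewrite addrC subrK.
have pcp : pc + p = 1%:M by rewrite subrK.
have qqc : q + qc = 1%:M by rewrite addrC subrK.
have qcq : qc + q = 1%:M by rewrite subrK.
have pcP0 w : w \in P0 -> pc *m w = w by move=> /pP0 h; rewrite mulmxBl mul1mx h subr0.
have qcL w : w \in Lt -> qc *m w = 0 by move=> /qLt h; rewrite mulmxBl mul1mx h subrr.
have qcqc : qc *m qc = qc.
  by rewrite mulmxBl mul1mx mulmxBr mulmx1 qq subrr subr0.
have c1 := orbit_cone aU GU ppc K1 pK pcK B0 dom T0 BT K20 comp GB eta0 Bteta small
  qqc pL0 qPt d1 B'0 b'0 qcK qdom.
have GB' s : is_derive s (1 : R) (fun s => G (- s)) (G (- s) *m - Bt (- s)).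
  have GBs : is_derive (0 + s * -1) (1 : R) G (G (- s) *m Bt (- s)).
    by rewrite add0r mulrN1; exact: GB.
  have := is_derive_affine GBs; rewrite scaleN1r mulmxN.
  by under eq_fun do rewrite add0r mulrN1.
have Bteta' s w : onorm (a (- s)) (- Bt (- s) *m w) <= eta * onorm (a (- s)) w.
  by rewrite mulNmx onormN.
have c2 := @orbit_cone (fun s => a (- s)) (fun s => G (- s)) (fun s => - Bt (- s))
  pc p qc q P0 Lt K B b T K2 eta K' B' b' (fun s => aU _) (fun s => GU _) pcp K1
  (fun s => pcK _) (fun s => pK _) B0 (dominated_orbit_rev dom) T0 BT K20
  (comparable_orbit_rev comp) GB' eta0 Bteta' small qcq pcP0 qcL d2 B'0 b'0
  (fun s => qK _) (dominated_orbit_rev qdom).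
rewrite /= oppr0 in c2.
set W := invmx (G 0) in c1 c2 *.
have WK z : W *m (G 0 *m z) = z by rewrite mulKmx.
set th := K * _ in small c1 c2 *.
have {}c1 := c1 (q *m (G 0 *m u)); rewrite mulmxA qq in c1.
have {}c2 := c2 (qc *m (G 0 *m u)); rewrite mulmxA qcqc in c2.
have {}c1 := c1 erefl; have {}c2 := c2 erefl.
set x := W *m (q *m (G 0 *m u)) in c1; set y := W *m (qc *m (G 0 *m u)) in c2.
have uE : x + y = u by rewrite /x /y -!mulmxDr -mulmxDl qqc mul1mx WK.
have -> : (W *m q *m G 0 - p) *m u = pc *m x - p *m y.
  have -> : (W *m q *m G 0 - p) *m u = x - p *m u by rewrite mulmxBl -!mulmxA.
  by rewrite -uE mulmxDr /pc mulmxBl mul1mx opprD addrA.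
have th0 : 0 <= th.
  rewrite /th mulr_ge0 ?(le_trans ler01 K1) // mulr_ge0 // ltW //.
  by rewrite !mulr_gt0 // exprn_gt0.
apply: le_trans (ler_onormB _ _ _) _.
have px : onorm (a 0) (p *m x) <= K * onorm (a 0) u + onorm (a 0) (p *m y).
  have -> : p *m x = p *m u - p *m y by rewrite -uE mulmxDr addrK.
  by apply: le_trans (ler_onormB _ _ _) _; rewrite lerD2r.
have pcy : onorm (a 0) (pc *m y) <= K * onorm (a 0) u + onorm (a 0) (pc *m x).
  have -> : pc *m y = pc *m u - pc *m x by rewrite -uE mulmxDr addrC addKr.
  by apply: le_trans (ler_onormB _ _ _) _; rewrite lerD2r.
set X1 := onorm _ (p *m x) in c1 px *; set X2 := onorm _ (pc *m x) in c1 pcy *.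
set Y1 := onorm _ (p *m y) in c2 px *; set Y2 := onorm _ (pc *m y) in c2 pcy *.
set N := onorm (a 0) u in px pcy *.
have X20 : 0 <= X2 by exact: onorm_ge0.
have Y10 : 0 <= Y1 by exact: onorm_ge0.
(* With X1 <= K N + Y1 and Y2 <= K N + X2, the sum of the cone estimates reads X2 + Y1 <= 8 th (2 K
   N + X2 + Y1). Since 8 th <= 1/2, half of the left side absorbs X2 + Y1, which leaves 32 K th
   N. *)
have t1 := ler_wpM2l th0 px; have t2 := ler_wpM2l th0 pcy.
have s1 := ler_wpM2r X20 small; have s2 := ler_wpM2r Y10 small.
lra.
Qed.

End Orbit.

(** * Uniformly hyperbolic bundles for the trivial connection *)

Section Geodesics.
Context {R : realType}.
Implicit Types x : UH2 R.

Lemma geodesicD (r s : R) x : geodesic r (geodesic s x) = geodesic (r + s) x.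
Proof.
apply: val_inj => /=; rewrite /foot /dir /=.
have chD : ch (r + s) = ch r * ch s + sh r * sh s.
  by rewrite /ch /sh opprD !expRD; field.
have shD : sh (r + s) = sh r * ch s + ch r * sh s.
  by rewrite /ch /sh opprD !expRD; field.
by rewrite chD shD; congr (_, _); apply/matrixP => i j; rewrite !mxE; ring.
Qed.

Lemma geodesic0 x : geodesic 0 x = x.
Proof.
apply: val_inj => /=; rewrite /foot /dir /= /ch /sh oppr0 expR0.
rewrite subrr mul0r !scale0r addr0 add0r -[2]/(1 + 1) divff ?scale1r //.
by case: (\val x).
Qed.

Lemma continuous_geodesic x : continuous (fun s : R => geodesic s x).
Proof.
have eC : continuous (@expR R) by exact: continuous_expR.
have eNC : continuous (fun s : R => expR (- s)).
  move=> s; apply: (@continuous_comp _ _ _ -%R (@expR R)); first exact: opp_continuous.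
  exact: eC.
have chC : continuous (@ch R).
  by move=> s; apply: cvgM; [apply: cvgD; [exact: eC|exact: eNC]|exact: cvg_cst].
have shC : continuous (@sh R).
  by move=> s; apply: cvgM; [apply: cvgB; [exact: eC|exact: eNC]|exact: cvg_cst].
have comb (k l : R -> R) (v w : 'rV[R]_3) : continuous k -> continuous l ->
    continuous (fun s => k s *: v + l s *: w).
  move=> kC lC s; apply/cvg_mxP => i j; rewrite !mxE.
  under eq_fun do rewrite !mxE.
  apply: cvgD; apply: cvgM; try exact: cvg_cst.
    exact: kC.
  exact: lC.
apply: (@continuous_comp_initial (set_type (@unit_tangent R)) _ _ set_val) => s.
apply: (@cvg_pair _ _ _ _ (nbhs (_ : 'rV[R]_3)) (nbhs (_ : 'rV[R]_3))); exact: comb.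
Qed.

End Geodesics.

(** * From the definition of hyperbolicity to projectors constant along geodesics *)

Section HyperbolicBundles.
Context {R : realType} {n : nat}.
Implicit Types (h p : UH2 R -> 'M[R]_n) (x : UH2 R).

Lemma fnormE h x u : fnorm h x u = onorm (invmx (h x)) u.
Proof. by []. Qed.

Lemma trivial_transport (Phi : R -> UH2 R -> 'M[R]_n) :
  is_transport trivial_connection Phi -> forall s x, Phi s x = 1%:M.
Proof.
move=> H s x; have [P0 dP] := H x; rewrite -P0; apply/matrixP => i j.
apply: (@is_derive_0_is_cst R (fun r => Phi r x i j)) => r.
by have /is_derive_mxP /(_ i j) := dP r; rewrite mul0mx oppr0 mxE.
Qed.

Lemma grass_dist_self h x (F : {vspace 'cV[R]_n}) : grass_dist h x F F <= 0.
Proof.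
rewrite /grass_dist maxxx.
set S := [set _ | _ in _].
(* The set is empty when [F] is 0; its [sup] is then 0. *)
have [S0|/set0P Sne] := eqVneq S set0; first by rewrite S0 sup0.
apply: ge_sup => // _ [u [uF _] <-].
apply: (@le_trans _ _ (fnorm h x (u - u))).
  apply: ge_inf; last by exists u.
  by exists 0 => _ [v _ <-]; exact: sqrtr_ge0.
by rewrite subrr fnormE onorm0.
Qed.

Lemma in_closure_self h (L : UH2 R -> {vspace 'cV[R]_n}) x :
  in_closure h L x (L x).
Proof.
split=> // e U e0 /nbhs_singleton Ux; exists x; split=> //.
exact: le_lt_trans (grass_dist_self _ _ _) e0.
Qed.

(** The angle bound, applied to [u] and to [- u], gives |<u, v>| < c |u| |v| with c = cos (2 e0).
    Hence (1 - c) (|u|^2 + |v|^2) <= |u + v|^2, so both projections are bounded. *)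
Lemma closure_transverse_bound h (L P : UH2 R -> {vspace 'cV[R]_n}) :
  (forall x, h x \in unitmx) -> closure_transverse h L P ->
  exists2 K : R, 1 <= K & forall x u v, u \in L x -> v \in P x ->
    fnorm h x u <= K * fnorm h x (u + v) /\ fnorm h x v <= K * fnorm h x (u + v).
Proof.
move=> hU [e0 [e0gt0 H]].
pose c : R := cos (2 * e0).
(* That [c < 1] will follow only where both summands contain nonzero vectors; the absolute value and
   the summand 1 keep the constant at least 1 in all cases. *)
have K1 : 1 <= 1 + `|(1 - c)^-1| by rewrite lerDl.
exists (1 + `|(1 - c)^-1|) => // x u v uL vP.
have aU : invmx (h x) \in unitmx by rewrite unitmx_inv.
have [->|u0] := eqVneq u 0.
  rewrite add0r !fnormE onorm0 mulr_ge0 ?onorm_ge0 ?(le_trans ler01) //.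
  by rewrite ler_peMl // onorm_ge0.
have [->|v0] := eqVneq v 0.
  rewrite addr0 !fnormE onorm0 mulr_ge0 ?onorm_ge0 ?(le_trans ler01) //.
  by rewrite ler_peMl // onorm_ge0.
have {H} H := H x _ _ (@in_closure_self h L x) (@in_closure_self h P x).
have Hc w : w \in L x -> w != 0 -> c < 1 /\
    inner h x w v < c * (fnorm h x w * fnorm h x v).
  move=> wL w0.
  set z := inner h x w v / (fnorm h x w * fnorm h x v).
  have nwv : 0 < fnorm h x w * fnorm h x v by rewrite mulr_gt0 // fnormE onorm_gt0.
  have zE : inner h x w v = z * (fnorm h x w * fnorm h x v).
    by rewrite mulrVK // unitfE gt_eqF.
  have z1 : -1 <= z <= 1.
    rewrite -ler_norml -(ler_pM2r nwv) -[X in _ * X <= _]gtr0_norm // -normrM -zE mul1r.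
    exact: edot_le.
  have : (2 * e0 < acos z).
    rewrite -lte_fin; apply: lt_le_trans H _; apply: ereal_inf_lbound.
    by exists w, v; split.
  have [/andP[z0 zpi] cz] := acos_def z1 => ez.
  have e2 : 0 < 2 * e0 by rewrite mulr_gt0.
  have eI : 2 * e0 \in `[0, pi] by rewrite in_itv /= ltW // (le_trans (ltW ez)).
  have zI : acos z \in `[0, pi] by rewrite in_itv /= z0.
  split.
    rewrite -[ltRHS](@cos0 R) ltr_cos //.
    by rewrite in_itv /= lexx pi_ge0.
  by rewrite zE ltr_pM2r // -[ltLHS]cz ltr_cos.
have [c1 uv] := Hc u uL u0.
have [_ nuv] : c < 1 /\ inner h x (- u) v < c * (fnorm h x (- u) * fnorm h x v).
  by apply: Hc; rewrite ?memvN ?oppr_eq0.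
have iN : inner h x (- u) v = - inner h x u v.
  by rewrite /inner mulmxN -/(edot _ _) edotNl.
rewrite iN !fnormE onormN -!fnormE in nuv.
have e : fnorm h x (u + v) ^+ 2 =
    fnorm h x u ^+ 2 + 2 * inner h x u v + fnorm h x v ^+ 2.
  rewrite !fnormE /onorm !enorm2 mulmxDr edotDl !edotDr.
  rewrite /inner -/(edot _ _) (edotC (_ *m v)); ring.
set A := fnorm h x u in uv nuv e *; set B := fnorm h x v in uv nuv e *.
have A0 : 0 <= A by exact: onorm_ge0.
have B0 : 0 <= B by exact: onorm_ge0.
have S0 : 0 <= fnorm h x (u + v) by exact: onorm_ge0.
set S := fnorm h x (u + v) in e S0 *.
have AB0 : 0 <= A * B by rewrite mulr_ge0.
have ABgt : 0 < A * B by rewrite mulr_gt0 // /A /B fnormE onorm_gt0.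
have c0 : 0 <= c.
  by rewrite -(pmulr_lge0 _ ABgt); lra.
have c1' : 0 < 1 - c by rewrite subr_gt0.
have main : (1 - c) * (A ^+ 2 + B ^+ 2) <= S ^+ 2.
  have : c * (2 * (A * B)) <= c * (A ^+ 2 + B ^+ 2).
    by apply: ler_wpM2l => //; have := sqr_ge0 (A - B); rewrite sqrrB mulr_natl; lra.
  rewrite e; lra.
(* As 0 < 1 - c <= 1, one has (1 - c)^2 <= 1 - c, so (1 - c)^-1 can serve in place of its square
   root. *)
have fin y : 0 <= y -> y ^+ 2 <= A ^+ 2 + B ^+ 2 -> y <= (1 + `|(1 - c)^-1|) * S.
  move=> y0 yAB; apply: (@le_trans _ _ ((1 - c)^-1 * S)); last first.
    by rewrite ler_wpM2r // (le_trans (ler_norm _)) // lerDr.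
  rewrite ler_pdivlMl // -(@ler_pXn2r _ 2) ?nnegrE ?mulr_ge0 // ?(ltW c1') //.
  rewrite exprMn; apply: le_trans main.
  apply: (@le_trans _ _ ((1 - c) * y ^+ 2)); last by rewrite ler_wpM2l // ltW.
  rewrite ler_wpM2r ?sqr_ge0 // expr2; apply: ler_piMl; first exact: ltW.
  by rewrite gerBl.
by split; apply: fin => //; rewrite ?lerDl ?lerDr sqr_ge0.
Qed.

(* Parallel transport for the trivial connection is the identity, so
   domination compares the norms of a fixed vector at different points. *)
Record hyperbolic_projector (k : nat) h p (L P : UH2 R -> {vspace 'cV[R]_n})
    (K B b C : R) : Prop := HyperbolicProjector {
  hp_unit : forall x, h x \in unitmx;
  hp_K1 : 1 <= K;
  hp_B1 : 1 <= B;
  hp_b0 : 0 < b;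
  hp_C1 : 1 <= C;
  hp_split : is_splitting k L P;
  hp_L : forall x u, u \in L x -> p x *m u = u;
  hp_P : forall x u, u \in P x -> p x *m u = 0;
  hp_memL : forall x u, p x *m u \in L x;
  hp_memP : forall x u, (1%:M - p x) *m u \in P x;
  hp_bound : forall x u, onorm (invmx (h x)) (p x *m u) <= K * onorm (invmx (h x)) u;
  hp_boundc : forall x u,
    onorm (invmx (h x)) ((1%:M - p x) *m u) <= K * onorm (invmx (h x)) u;
  hp_flow : forall x s, p (geodesic s x) = p x;
  hp_dom : forall x, dominated_orbit (fun s => invmx (h (geodesic s x)))
    (p x) (1%:M - p x) B b;
  hp_step : forall x u,
    onorm (invmx (h (geodesic 1 x))) u <= C * onorm (invmx (h x)) u /\
    onorm (invmx (h x)) u <= C * onorm (invmx (h (geodesic 1 x))) u }.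

Lemma fundamental_projector_hyperbolic k h p :
  fundamental_projector k trivial_connection h p ->
  exists L P K B b C, hyperbolic_projector k h p L P K B b C.
Proof.
move=> [L [P [[[_ hU] _ spl [Phi [tr [C0 HC]] [iL iP] _ [B0 [b [B0gt b0 dom]]]] [ct _]] pLP]]].
have PhiE := trivial_transport tr.
have [K K1 HK] := closure_transverse_bound hU ct.
have memL x u : p x *m u \in L x /\ (1%:M - p x) *m u \in P x.
  have [_ LP _] := spl x; have [pL pP] := pLP x.
  have : u \in (L x + P x)%VS by rewrite LP memvf.
  move=> /memv_addP[l lL [v vP ->]].
  rewrite mulmxDr pL // pP // addr0 lL; split=> //.
  by rewrite mulmxBl mul1mx mulmxDr pL // pP // addr0 addrC addKr.
have Lflow s x : L (geodesic s x) = L x.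
  by apply/vspaceP => u; rewrite (iL s x u) PhiE mul1mx.
have Pflow s x : P (geodesic s x) = P x.
  by apply/vspaceP => u; rewrite (iP s x u) PhiE mul1mx.
have uE x (u : 'cV[R]_n) : u = p x *m u + (1%:M - p x) *m u by rewrite mulmxBl mul1mx addrC subrK.
have flow x s : p (geodesic s x) = p x.
  have H (u : 'cV[R]_n) : p (geodesic s x) *m u = p x *m u.
    have [l v] := memL x u; have [pL pP] := pLP (geodesic s x).
    rewrite Lflow in pL; rewrite Pflow in pP.
    by rewrite {1}(uE x u) mulmxDr pL // pP // addr0.
  apply/matrixP => i j.
  have := H (delta_mx j 0); move=> /(congr1 (fun w : 'cV_n => w i 0)).
  by rewrite -!colE !mxE.
have onU x : invmx (h x) \in unitmx by rewrite unitmx_inv.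
(* The maximum of [B0] with 1 extends domination to equal times, where the two sides differ by the
   constant only. *)
exists L, P, K, (Num.max 1 B0), b, (Num.max 1 C0); split => //.
- by rewrite le_max lexx.
- by rewrite le_max lexx.
- by move=> x u uL; have [pL _] := pLP x; apply: pL.
- by move=> x u uP; have [_ pP] := pLP x; apply: pP.
- by move=> x u; have [] := memL x u.
- by move=> x u; have [] := memL x u.
- move=> x u; have [l v] := memL x u; have [H _] := HK x _ _ l v.
  by rewrite -uE in H.
- move=> x u; have [l v] := memL x u; have [_ H] := HK x _ _ l v.
  by rewrite -uE in H.
- move=> x r s u v rs.
  have [lu _] := memL x u; have [_ vv] := memL x v.
  set l := p x *m u in lu *; set w := (1%:M - p x) *m v in vv *.
  have [->|l0] := eqVneq l 0; first by rewrite !onorm0 mulr0 mul0r mulr0.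
  have [->|w0] := eqVneq w 0; first by rewrite !onorm0 mulr0 mul0r mulr0.
  have np y := onorm_gt0 (onU y) l0; have nw y := onorm_gt0 (onU y) w0.
  move: rs; rewrite le_eqVlt => /orP[/eqP <-|rs].
    rewrite subrr mulr0 oppr0 expR0 mulr1 mulrC ler_peMl ?le_max ?lexx //.
    by rewrite ltW // mulr_gt0.
  have sr0 : 0 < s - r by rewrite subr_gt0.
  have := dom (geodesic r x) (s - r) l w sr0.
  rewrite Lflow Pflow PhiE !mul1mx geodesicD subrK => /(_ lu l0 vv w0).
  rewrite !fnormE; set X1 := onorm _ l; set X2 := onorm _ l; set Y1 := onorm _ w.
  set Y2 := onorm _ w.
  have X20 : 0 < X2 by exact: np.
  have Y20 : 0 < Y2 by exact: nw.
  rewrite ler_pdivrMr // => hXY.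
  have : X1 * Y2 <= B0 * expR (- (b * (s - r))) * (Y1 * X2).
    apply: le_trans (ler_wpM2r (ltW Y20) hXY) _.
    apply: eq_ler; field.
    by rewrite gt_eqF.
  move=> /le_trans; apply; rewrite ler_wpM2r ?mulr_ge0 ?onorm_ge0 // ler_wpM2r ?expR_ge0 //.
  by rewrite le_max lexx orbT.
- move=> x u.
  have [H1 _] := HC x u; have [_ H2] := HC (geodesic 1 x) u.
  rewrite !PhiE !mul1mx !fnormE geodesicD addNr geodesic0 in H1 H2.
  by split; [apply: le_trans H1 _|apply: le_trans H2 _];
    rewrite ler_wpM2r ?onorm_ge0 // le_max lexx orbT.
Qed.

End HyperbolicBundles.

(** * Comparison of the norms at different points of a geodesic *)

Section Comparison.
Context {R : realType} {n k : nat}.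
Variables (h p : UH2 R -> 'M[R]_n) (L P : UH2 R -> {vspace 'cV[R]_n}).
Variables (K B b C : R).
Hypothesis hp : hyperbolic_projector k h p L P K B b C.
Hypothesis k_gt0 : (0 < k)%N.
Hypothesis k_ltn : (k < n)%N.

Let N x u := onorm (invmx (h x)) u.
(** [D] combines domination from r to 1 with two bounds for a flow of time 1: one brings a vector of
    [L] from 1 back to 0, the other a vector of [P] from 0 to 1. In [K2], [D] is squared since
    vectors of [L] are compared through a vector of [P], and [2 * K] recombines the two
    components. *)
Let D := C ^+ 2 * B.
Let K2 := 2 * K * D ^+ 2.

Let N0 x u : 0 <= N x u. Proof. exact: onorm_ge0. Qed.

Let N_gt0 x u : u != 0 -> 0 < N x u.
Proof. by move=> u0; rewrite /N onorm_gt0 // unitmx_inv (hp_unit hp). Qed.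

Let K0 : 0 <= K. Proof. exact: le_trans (hp_K1 hp). Qed.
Let C0 : 0 <= C. Proof. exact: le_trans (hp_C1 hp). Qed.
Let B0 : 0 <= B. Proof. exact: le_trans (hp_B1 hp). Qed.

Let D1 : 1 <= D.
Proof.
rewrite /D -[leLHS]mulr1 ler_pM //; last exact: hp_B1 hp.
by rewrite exprn_ege1 // (hp_C1 hp).
Qed.

Let BD : B <= D.
Proof. by rewrite /D ler_peMl // exprn_ege1 // (hp_C1 hp). Qed.

Let K2_1 : 1 <= K2.
Proof.
rewrite /K2 -[leLHS]mulr1 ler_pM //; last by rewrite exprn_ege1.
by rewrite -[leLHS]mulr1 ler_pM // ?ler1n //; exact: hp_K1 hp.
Qed.

Let dom x r s l v : r <= s -> p x *m l = l -> p x *m v = 0 ->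
  N (geodesic s x) l * N (geodesic r x) v <=
  B * (N (geodesic s x) v * N (geodesic r x) l).
Proof.
move=> rs pl pv; have := hp_dom hp x l v rs.
have -> : (1%:M - p x) *m v = v by rewrite mulmxBl mul1mx pv subr0.
rewrite pl => /le_trans; apply; rewrite ler_wpM2r ?mulr_ge0 ?N0 //.
rewrite ler_piMr // -expR0 ler_expR oppr_le0 mulr_ge0 ?subr_ge0 //.
exact: ltW (hp_b0 hp).
Qed.

(* As [L] is dominated by [P] both from time 0 to time r and from time r to
   time 1, the growth from 0 to r of all vectors is the same up to a factor. *)
Let comparable_unit x r : 0 <= r -> r <= 1 ->
  exists2 c : R, 0 < c &
    forall u, N (geodesic r x) u <= K2 * (c * N x u) /\
              c * N x u <= K2 * N (geodesic r x) u.
Proof.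
move=> r0 r1.
have x0 : geodesic 0 x = x by exact: geodesic0.
have lv l v : p x *m l = l -> p x *m v = 0 ->
    N (geodesic r x) l * N x v <= D * (N (geodesic r x) v * N x l) /\
    N (geodesic r x) v * N x l <= D * (N (geodesic r x) l * N x v).
  move=> pl pv; have := dom r0 pl pv; rewrite x0 => H1; split.
    by apply: le_trans H1 _; rewrite ler_wpM2r ?mulr_ge0.
  have H2 := dom r1 pl pv.
  have [Cv _] := hp_step hp x v; have [_ Cl] := hp_step hp x l.
  rewrite -!/(N _ _) in Cv Cl.
  have s1 : N (geodesic r x) v * N x l <= C * (N (geodesic 1 x) l * N (geodesic r x) v).
    by apply: le_trans (ler_wpM2l (N0 _ _) Cl) _; apply: eq_ler; ring.
  apply: le_trans s1 _; apply: le_trans (ler_wpM2l C0 H2) _.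
  have CB : 0 <= C * B * N (geodesic r x) l by rewrite !mulr_ge0.
  have := ler_wpM2l CB Cv; rewrite /D expr2; lra.
have [dL LP LP0] := hp_split hp x.
have dP : (0 < \dim (P x))%N.
  have := dimv_sum_cap (L x) (P x); rewrite LP LP0 dimv0 addn0 dimvf /dim /= muln1.
  by rewrite dL => nE; rewrite -(ltn_add2l k) addn0 -nE.
have [l0 l0L l0n] : exists2 l, l \in L x & l != 0.
  by exists (vpick (L x)); rewrite ?memv_pick // vpick0 -dimv_eq0 dL -lt0n.
have [v0 v0P v0n] : exists2 v, v \in P x & v != 0.
  by exists (vpick (P x)); rewrite ?memv_pick // vpick0 -dimv_eq0 -lt0n.
have pl0 := hp_L hp l0L; have pv0 := hp_P hp v0P.
(* The scalar is the growth of one reference vector of [L]. Vectors of [P] are compared with it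
   directly, vectors of [L] through the reference vector [v0] of [P]. *)
pose c := N (geodesic r x) l0 / N x l0.
have c0 : 0 < c by rewrite divr_gt0 // N_gt0.
have ED : 0 <= D by apply: le_trans D1.
have cE : N (geodesic r x) l0 = c * N x l0 by rewrite mulrVK // unitfE gt_eqF // N_gt0.
have nl0 := N_gt0 x l0n; have nv0 := N_gt0 x v0n.
have cv v : p x *m v = 0 -> N (geodesic r x) v <= D * (c * N x v) /\
    c * N x v <= D * N (geodesic r x) v.
  move=> pv; have [H1 H2] := lv _ _ pl0 pv; rewrite cE in H1 H2.
  split; rewrite -(ler_pM2r nl0); first by apply: le_trans H2 _; apply: eq_ler; ring.
  by rewrite mulrAC -mulrA [X in _ <= X]mulrAC; apply: le_trans (le_trans _ H1) _;
    apply: eq_ler; ring.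
have cl l : p x *m l = l -> N (geodesic r x) l <= D ^+ 2 * (c * N x l) /\
    c * N x l <= D ^+ 2 * N (geodesic r x) l.
  move=> pl; have [H1 H2] := lv _ _ pl pv0; have [H3 H4] := cv _ pv0.
  split; rewrite -(ler_pM2r nv0).
    apply: le_trans H1 _.
    have := ler_wpM2l (mulr_ge0 ED (N0 x l)) H3; rewrite expr2; lra.
  have := ler_wpM2l (N0 x l) H4; have := ler_wpM2l ED H2; rewrite expr2; lra.
exists c => // u.
have D2 : D <= D ^+ 2 by rewrite expr2 ler_peMl.
have cc v : 0 <= c * N x v by rewrite mulr_ge0 // ltW.
have [l1 l2] := cl _ (hp_L hp (hp_memL hp x u)).
have [v1 v2] := cv _ (hp_P hp (hp_memP hp x u)).
have uE : p x *m u + (1%:M - p x) *m u = u by rewrite mulmxBl mul1mx addrC subrK.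
set l := p x *m u in l1 l2 uE; set v := _ *m u in v1 v2 uE.
have {}v1 : N (geodesic r x) v <= D ^+ 2 * (c * N x v).
  by apply: le_trans v1 _; rewrite ler_wpM2r.
have {}v2 : c * N x v <= D ^+ 2 * N (geodesic r x) v.
  by apply: le_trans v2 _; rewrite ler_wpM2r.
have D20 : 0 <= D ^+ 2 by exact: sqr_ge0.
have b1 y : N y u <= N y l + N y v by rewrite -uE ler_onormD.
have b2 : N x l <= K * N x u by exact: hp_bound hp x u.
have b3 : N x v <= K * N x u by exact: hp_boundc hp x u.
have b4 : N (geodesic r x) l <= K * N (geodesic r x) u.
  by have := hp_bound hp (geodesic r x) u; rewrite (hp_flow hp).
have b5 : N (geodesic r x) v <= K * N (geodesic r x) u.
  by have := hp_boundc hp (geodesic r x) u; rewrite (hp_flow hp).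
split.
  apply: le_trans (b1 _) _.
  have Dc : 0 <= D ^+ 2 * c by rewrite mulr_ge0 // ltW.
  have := ler_wpM2l Dc b2; have := ler_wpM2l Dc b3; rewrite /K2; lra.
apply: le_trans (ler_wpM2l (ltW c0) (b1 x)) _.
have := ler_wpM2l D20 b4; have := ler_wpM2l D20 b5; rewrite /K2; lra.
Qed.

Let comparable_nat m x s : 0 <= s -> s <= m%:R ->
  exists2 c : R, 0 < c &
    forall u, N (geodesic s x) u <= K2 ^+ m * (c * N x u) /\
              c * N x u <= K2 ^+ m * N (geodesic s x) u.
Proof.
elim: m x s => [|m IH] x s s0 sm.
  have -> : s = 0 by apply/eqP; rewrite eq_le s0 sm.
  by exists 1 => // u; rewrite expr0 !mul1r geodesic0 lexx.
have K20 : 0 <= K2 by apply: le_trans K2_1.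
have [s1|/ltW s1] := leP s 1.
  have [c c0 H] := comparable_unit x s0 s1; exists c => // u.
  have [H1 H2] := H u.
  have e : K2 <= K2 ^+ m.+1 by rewrite exprS ler_peMr // exprn_ege1.
  have cN : 0 <= c * N x u by rewrite mulr_ge0 // ltW.
  split; [apply: le_trans H1 _|apply: le_trans H2 _]; exact: ler_wpM2r.
have [c c0 H] := comparable_unit x ler01 (lexx 1).
have s1m : s - 1 <= m%:R by rewrite lerBlDr -natr1 in sm *.
have s10 : 0 <= s - 1 by rewrite subr_ge0.
have [c' c'0 H'] := IH (geodesic 1 x) (s - 1) s10 s1m.
exists (c' * c) => [|u]; first by rewrite mulr_gt0.
rewrite geodesicD subrK in H'.
have [H1 H2] := H u; have [H3 H4] := H' u.
have Km : 0 <= K2 ^+ m by rewrite exprn_ge0.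
split.
  have := ler_wpM2l (mulr_ge0 Km (ltW c'0)) H1; rewrite exprS; lra.
have := ler_wpM2l (ltW c'0) H2; have := ler_wpM2l K20 H4; rewrite exprS; lra.
Qed.

Lemma hyperbolic_comparable (T : R) : exists2 K' : R, 0 < K' &
  forall x, comparable_orbit (fun s => invmx (h (geodesic s x))) T K'.
Proof.
pose m := (Num.truncn T).+1.
have Tm : T <= m%:R by exact: ltW (truncnS_gt _).
exists (K2 ^+ m); first by rewrite exprn_gt0 // (lt_le_trans _ K2_1).
have K20 : 0 <= K2 ^+ m by rewrite exprn_ge0 // (le_trans _ K2_1).
move=> x r s; have [rs|/ltW sr] := leP r s.
  rewrite ger0_norm ?subr_ge0 // => srT.
  have sr0 : 0 <= s - r by rewrite subr_ge0.
  have [c c0 H] := comparable_nat (geodesic r x) sr0 (le_trans srT Tm).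
  by rewrite geodesicD subrK in H; exists c.
rewrite distrC ger0_norm ?subr_ge0 // => srT.
have sr0 : 0 <= r - s by rewrite subr_ge0.
have [c c0 H] := comparable_nat (geodesic s x) sr0 (le_trans srT Tm).
rewrite geodesicD subrK in H; exists c^-1 => [|u]; first by rewrite invr_gt0.
have [H1 H2] := H u.
split.
  by rewrite mulrCA ler_pdivlMl.
by rewrite ler_pdivrMl // mulrCA.
Qed.

End Comparison.

(** * Estimates extracted from a bounded variation *)

Section Variation.
Context {R : realType} {n : nat}.

Lemma family_compact_dist {T : topologicalType} {X : set_system R} {FX : Filter X}
    (F : R -> T -> 'M[R]_n) (f : T -> 'M[R]_n) (A : set T) (e : R) :
  {family compact, F r @[r --> X] --> f} -> compact A -> 0 < e ->
  \forall r \near X, forall y, A y -> `|f y - F r y| < e.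
Proof.
move=> /fam_cvgP H cA e0; have := H A cA.
move=> /(_ [set g | forall y, A y -> `|f y - g y| < e]); apply.
apply/uniform_nbhs; exists [set xy | `|xy.1 - xy.2| < e]; split=> //.
rewrite -entourage_ballE; exists e => //= -[y z] /=.
by rewrite -ball_normE.
Qed.

Lemma family_compact_pointwise {T : topologicalType} {X : set_system R} {FX : Filter X}
    (F : R -> T -> 'M[R]_n) (f : T -> 'M[R]_n) x :
  {family compact, F r @[r --> X] --> f} -> F r x @[r --> X] --> f x.
Proof.
move=> H; apply/cvgrPdist_lt => e e0.
have := @family_compact_dist T X FX F f [set x] e H (@compact_set1 _ x) e0.
by apply: filterS => r Hr; exact: Hr.
Qed.

(** The scaling s * t of [0, 1] covers both signs of [t]; the increment is then paired with itself
    to obtain a scalar function. *)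
Lemma mean_value_onorm (a : 'M[R]_n) (B dB : R -> 'M[R]_n) (c t : R) (u : 'cV[R]_n) :
  (forall s : R, `|s| <= `|t| -> is_derive s (1 : R) B (dB s)) ->
  (forall s, `|s| <= `|t| -> onorm a (dB s *m u) <= c) ->
  onorm a (B t *m u - B 0 *m u) <= c * `|t|.
Proof.
move=> BdB dBc.
set z := a *m (B t *m u - B 0 *m u).
have c0 : 0 <= c by apply: le_trans (dBc 0 _); rewrite ?onorm_ge0 // normr0.
have [z0|zn0] := eqVneq (enorm z) 0; first by rewrite /onorm -/z z0 mulr_ge0.
have zgt0 : 0 < enorm z by rewrite lt_neqAle eq_sym zn0 enorm_ge0.
have st (s : R) : s \in `[0, 1] -> `|s * t| <= `|t|.
  by rewrite in_itv /= => /andP[s0 s1]; rewrite normrM (ger0_norm s0) ler_piMl.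
have df (s : R) : s \in `[0, 1] -> is_derive s (1 : R)
    (fun s => edot (a *m (B (0 + s * t) *m u)) z) (edot (a *m ((t *: dB (s * t)) *m u)) z).
  move=> sI; have Bs : is_derive (0 + s * t) (1 : R) B (dB (s * t)).
    by rewrite add0r; apply: BdB; apply: st.
  have := is_derive_affine Bs => /(is_derive_mulmxr u) /(is_derive_mulmxl a) H.
  by have := is_derive_edot H (is_derive_cst z s (1 : R)); rewrite /= edot0r addr0.
have [s sI] := mean_value ler01 df.
rewrite mul1r mul0r !add0r -edotBl -mulmxBr -/z -enorm2 subr0 mulr1 => zE.
rewrite /onorm -/z -(ler_pM2r zgt0) -expr2 zE.
apply: le_trans (ler_norm _) _; apply: le_trans (edot_le _ _) _.
rewrite ler_wpM2r ?enorm_ge0 // -scalemxAl -scalemxAr enormZ mulrC.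
by rewrite ler_wpM2r // dBc // st.
Qed.

(** [derive_along] differentiates at time 0; the group law of the flow carries this to any time. *)
Lemma smooth_derive_geodesic (G : UH2 R -> 'M[R]_n) x s : smooth G ->
  is_derive s (1 : R) (fun r => G (geodesic r x)) (derive_along Flow G (geodesic s x)).
Proof.
move=> /(_ 1%N) [_ /(_ Flow) [dG _]].
have H0 : is_derive (- s + s * 1) (1 : R) (fun r => G (geodesic r (geodesic s x)))
    (derive_along Flow G (geodesic s x)).
  rewrite mulr1 addNr; apply: DeriveDef; first exact: dG.
  by rewrite -derive1E.
have := is_derive_affine H0; rewrite scale1r.
by under eq_fun do rewrite geodesicD mulr1 addrAC addNr add0r.
Qed.

(** Along the flow the pullback of the trivial connection by G_t is [Bt] = G_t^-1 dG_t/ds. It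
    vanishes at t = 0 and its derivative in t is bounded near 0, whence the bound by [C] times |t|;
    [dB] is its derivative at t = 0. *)
Lemma bounded_variation_data (eps : R) (h : R -> UH2 R -> 'M[R]_n) : 0 < eps ->
  bounded_bundle_variation eps 2 (fun _ : R => trivial_connection) h ->
  exists (G Bt : R -> UH2 R -> 'M[R]_n) (dB : UH2 R -> 'M[R]_n) (C t1 : R),
  [/\ 0 < t1 /\ 0 < C,
      forall t x, `|t| < t1 -> [/\ h t x \in unitmx, G t x \in unitmx &
        G t x *m h 0 x = h t x],
      forall t x s, `|t| < t1 ->
        is_derive s (1 : R) (fun s => G t (geodesic s x))
          (G t (geodesic s x) *m Bt t (geodesic s x)),
      forall t x u, `|t| < t1 ->
        onorm (invmx (h 0 x)) (Bt t x *m u) <= C * `|t| * onorm (invmx (h 0 x)) u &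
      [/\ continuous dB,
          forall x u, onorm (invmx (h 0 x)) (dB x *m u) <= C * onorm (invmx (h 0 x)) u &
      {family compact, (fun x => r^-1 *: Bt r x) @[r --> (0 : R)^'] --> dB}]].
Proof.
move=> eps0 [hfr _ _ [G [HG [Hconn B0 [Bcont [dF [[dFcont _] HdF]]] [C HC]]]]].
pose Bt t x := pullback_connection (G t) trivial_connection Flow x -
  trivial_connection Flow x.
have e0 : `|0 : R| < eps by rewrite normr0.
have dBt (t : R) x : `|t| < eps -> is_derive t (1 : R) (fun r => Bt r x) (dF t x).
  move=> te; apply/is_derive1P.
  exact: (family_compact_pointwise (x := x) (HdF t te)).
have Bt0 x : Bt 0 x = 0 by rewrite /Bt B0 subrr.
move: HC => /nbhs_ballP[d /= d0 HC].
pose t1 := Num.min eps d.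
have t1e (t : R) : `|t| < t1 -> `|t| < eps /\ `|t| < d by rewrite lt_min => /andP[].
exists G, Bt, (dF 0), (Num.max 1 C), t1; split.
- by rewrite lt_min eps0 d0 lt_max ltr01.
- move=> t x /t1e [te _]; have [_ [_ hU]] := hfr t te; have [_ [_ h0U]] := hfr 0 e0.
  have [[_ GU] Gh] := HG t te; split => //.
  by rewrite -(Gh x) /pullback_frame mulKVmx.
- move=> t x s /t1e [te _]; have [[Gs GU] _] := HG t te.
  have -> : G t (geodesic s x) *m Bt t (geodesic s x) = derive_along Flow (G t) (geodesic s x).
    rewrite /Bt /pullback_connection /trivial_connection.
    by rewrite subr0 mulmx0 mul0mx add0r mulKVmx.
  exact: smooth_derive_geodesic.
- move=> t x u /t1e [te td].
  have := @mean_value_onorm (invmx (h 0 x)) (fun r => Bt r x) (fun r => dF r x)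
    (Num.max 1 C * onorm (invmx (h 0 x)) u) t u.
  rewrite Bt0 mul0mx subr0 mulrAC; apply=> s st.
    by apply: dBt; apply: le_lt_trans te.
  have sd : ball 0 d s by rewrite -ball_normE /ball_ /= sub0r normrN (le_lt_trans st).
  have := HC s sd x u; rewrite !fnormE derive1E.
  have Hs := dBt s x (le_lt_trans st te).
  rewrite (@derive_val _ _ _ _ _ _ _ Hs).
  move=> /le_trans; apply; rewrite ler_wpM2r ?onorm_ge0 // le_max lexx orbT //.
- split; first by apply: dFcont.
    move=> x u; have := HC 0 (ballxx _ d0) x u; rewrite !fnormE derive1E.
    rewrite (@derive_val _ _ _ _ _ _ _ (dBt 0 x e0)).
    by move=> /le_trans; apply; rewrite ler_wpM2r ?onorm_ge0 // le_max lexx orbT.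
  have -> : (fun r x => r^-1 *: Bt r x) = (fun r x => r^-1 *: (Bt (0 + r) x - Bt 0 x)).
    by apply/funext => r; apply/funext => x; rewrite add0r Bt0 subr0.
  exact: HdF.
Qed.

End Variation.

(** * Closeness of the projectors, uniformly over the unit tangent bundle *)

Section UniformCloseness.
Context {R : realType} {n k : nat}.
Implicit Types (h p : UH2 R -> 'M[R]_n) (x : UH2 R).

Lemma matrix_cV_ext m (M N : 'M[R]_(m, n)) :
  (forall u : 'cV[R]_n, M *m u = N *m u) -> M = N.
Proof.
move=> H; apply/matrixP => i j.
have := H (delta_mx j (0 : 'I_1)); move=> /(congr1 (fun w : 'cV_m => w i 0)).
by rewrite -!colE !mxE.
Qed.

Lemma hyperbolic_projector_idem h p L P (K B b C : R) x :
  hyperbolic_projector k h p L P K B b C -> p x *m p x = p x.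
Proof.
move=> hp; apply: matrix_cV_ext => u.
by rewrite -mulmxA (hp_L hp) // (hp_memL hp).
Qed.

Lemma splitting_dim (L P : UH2 R -> {vspace 'cV[R]_n}) x :
  is_splitting k L P -> \dim (L x) = k /\ (k + \dim (P x))%N = n.
Proof.
move=> /(_ x) [dL LP LP0]; split=> //.
have := dimv_sum_cap (L x) (P x).
by rewrite LP LP0 dimv0 addn0 dimvf /dim /= muln1 dL.
Qed.

(** For these ranks one summand is 0, so domination compares nothing; but the projector is 0 or the
    identity and cannot vary. *)
Lemma trivial_hyperbolic_projector h p L P (K B b C : R) x :
  hyperbolic_projector k h p L P K B b C -> ~~ ((0 < k) && (k < n))%N ->
  p x = if k == 0%N then 0 else 1%:M.
Proof.
move=> hp kn; apply: matrix_cV_ext => u.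
have [dL dP] := splitting_dim x (hp_split hp).
case: eqP => k0.
  have := hp_memL hp x u; have /eqP : \dim (L x) = 0%N by rewrite dL.
  by rewrite dimv_eq0 => /eqP ->; rewrite memv0 => /eqP ->; rewrite mul0mx.
have uP : (1%:M - p x) *m u = 0.
  have := hp_memP hp x u; have /eqP : \dim (P x) = 0%N.
    move: kn; rewrite lt0n (introN eqP k0) /= -leqNgt => nk.
    by apply/eqP; rewrite -leqn0 -(leq_add2l k) dP addn0.
  by rewrite dimv_eq0 => /eqP ->; rewrite memv0 => /eqP.
by rewrite mul1mx -[LHS]addr0 -uP mulmxBl mul1mx addrC subrK.
Qed.

(** The orbit estimate concerns time 0 of the orbit of x, with constants independent of x. As x is
    arbitrary, it holds at all points of every geodesic. *)
Lemma projector_close (h G Bt : R -> UH2 R -> 'M[R]_n) (p : R -> UH2 R -> 'M[R]_n)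
    (C t1 : R) : 0 < t1 -> 0 < C ->
  (forall t x, `|t| < t1 -> [/\ h t x \in unitmx, G t x \in unitmx &
    G t x *m h 0 x = h t x]) ->
  (forall t x s, `|t| < t1 -> is_derive s (1 : R) (fun s => G t (geodesic s x))
    (G t (geodesic s x) *m Bt t (geodesic s x))) ->
  (forall t x u, `|t| < t1 ->
    onorm (invmx (h 0 x)) (Bt t x *m u) <= C * `|t| * onorm (invmx (h 0 x)) u) ->
  (forall t, `|t| < t1 -> exists L P K B b c,
    hyperbolic_projector k (h t) (p t) L P K B b c) ->
  exists C1 t2 : R, [/\ 0 < t2, t2 <= t1, 0 <= C1 &
    forall t x u, `|t| < t2 ->
      onorm (invmx (h 0 x)) ((invmx (G t x) *m p t x *m G t x - p 0 x) *m u) <=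
      C1 * `|t| * onorm (invmx (h 0 x)) u].
Proof.
move=> t1gt0 C0 hG dG BtC hyp.
have t10 : `|0 : R| < t1 by rewrite normr0.
have [L [P [K [B [b [c hp]]]]]] := hyp 0 t10.
have [/andP[k0 kn]|kn] := boolP ((0 < k) && (k < n))%N; last first.
  exists 0, t1; split => // t x u tt1.
  have [L' [P' [K' [B' [b' [c' hp']]]]]] := hyp t tt1.
  have [_ GU _] := hG t x tt1.
  rewrite (trivial_hyperbolic_projector x hp kn) (trivial_hyperbolic_projector x hp' kn).
  case: eqP => _.
    by rewrite mulmx0 mul0mx subrr mul0mx onorm0 mulr_ge0 ?mulr_ge0 ?onorm_ge0.
  by rewrite mulmx1 mulVmx // subrr mul0mx onorm0 mulr_ge0 ?mulr_ge0 ?onorm_ge0.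
have K1 := hp_K1 hp; have B1 := hp_B1 hp; have b0 := hp_b0 hp.
have Kgt0 : 0 < K by apply: lt_le_trans K1.
have Bgt0 : 0 < B by apply: lt_le_trans B1.
(* Then exp (b T) = exp (8 B) >= 1 + 8 B, which makes the domination factor over time T at most
   1/8. *)
pose T := 8 * B / b.
have T0 : 0 < T by rewrite divr_gt0 // mulr_gt0.
have BT : 8 * (B * expR (- (b * T))) <= 1.
  have -> : b * T = 8 * B by rewrite /T; field; rewrite gt_eqF.
  rewrite mulrA expRN ler_pdivrMr ?expR_gt0 // mul1r.
  by apply: le_trans (expR_ge1Dx _); rewrite lerDr.
have [K2 K20 comp] := hyperbolic_comparable hp k0 kn (2 * T).
(* With eta = C |t|, the smallness condition becomes M |t| / 2 <= 1 and the final bound is K M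
   |t|. *)
pose M := 64 * K * (K2 ^+ 2 * C * T).
have M0 : 0 < M by rewrite /M !mulr_gt0 // invr_gt0.
exists (K * M), (Num.min t1 M^-1); split.
- by rewrite lt_min t1gt0 invr_gt0.
- by rewrite ge_min lexx.
- by rewrite mulr_ge0 // ltW.
move=> t x u; rewrite lt_min => /andP[tt1 tM].
(* The orbit estimate asks for eta > 0, hence for t != 0. At t = 0 both projectors coincide because
   G_0 is the identity. *)
have [t0|t0] := eqVneq t 0.
  have [hU GU Gh] := hG 0 x t10.
  have G1 : G 0 x = 1%:M by rewrite -[LHS](mulmxK hU) Gh mulmxV.
  rewrite t0 G1 invmx1 mul1mx mulmx1 subrr mul0mx onorm0.
  by rewrite mulr_ge0 ?onorm_ge0 // mulr_ge0 // mulr_ge0 // ltW.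
have t_gt0 : 0 < `|t| by rewrite normr_gt0.
have [Lt [Pt [K' [B' [b' [c' hp']]]]]] := hyp t tt1.
have aG y : invmx (h 0 y) *m invmx (G t y) = invmx (h t y).
  have [hU GU Gh] := hG t y tt1; have [h0U _ _] := hG 0 y t10.
  rewrite -[LHS](mulmxK hU) -Gh -(mulmxA _ (invmx (G t y))) mulKmx //.
  by rewrite mulVmx // mul1mx.
have [d1 d2] := splitting_dim x (hp_split hp).
have [d3 d4] := splitting_dim x (hp_split hp').
have e0 : 0 < C * `|t| by rewrite mulr_gt0.
have := @orbit_projector_close R n (fun s => invmx (h 0 (geodesic s x)))
  (fun s => G t (geodesic s x)) (fun s => Bt t (geodesic s x)) (p 0 x) (p t x)
  (L x) (P x) (Lt x) (Pt x) K B b T K2 (C * `|t|) K' B' b'.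
rewrite !geodesic0 => H.
apply: le_trans (H _ _ K1 _ _ (ltW Bgt0) (hp_dom hp x) T0 BT K20 (comp x) _ e0 _
  _ (hyperbolic_projector_idem x hp') _ _ _ _ _ _ _ _ _ _ _ u) _.
- by move=> s; rewrite unitmx_inv (hp_unit hp).
- by move=> s; have [] := hG t (geodesic s x) tt1.
- by move=> s v; rewrite -(hp_flow hp x s) (hp_bound hp).
- by move=> s v; rewrite -(hp_flow hp x s) (hp_boundc hp).
- by move=> s; apply: dG.
- by move=> s v; apply: BtC.
- have -> : 16 * (K * (2 * (K2 ^+ 2 * (C * `|t|) * T))) = 2^-1 * (M * `|t|).
    by rewrite /M; field.
  have : M * `|t| <= 1 by rewrite -ler_pdivlMl // mulr1 ltW.
  by have := mulr_gt0 M0 t_gt0; lra.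
- by move=> v; apply: (hp_L hp).
- by move=> v; apply: (hp_P hp).
- by move=> v; apply: (hp_L hp').
- by move=> v; apply: (hp_P hp').
- by rewrite d1.
- by rewrite d3 addnC.
- exact: le_trans ler01 (hp_B1 hp').
- exact: ltW (hp_b0 hp').
- by move=> s v; rewrite aG -(hp_flow hp' x s) (hp_bound hp').
- by move=> s v; rewrite aG -(hp_flow hp' x s) (hp_boundc hp').
- by move=> r s w v rs; rewrite !aG; apply: (hp_dom hp').
by apply: eq_ler; rewrite /M; ring.
Qed.

End UniformCloseness.

(** * Limits and integrals along a geodesic *)

Section ExponentialDecay.
Context {R : realType}.
Local Notation mu := lebesgue_measure.

Lemma ge0_FTC_integrable (f F : R -> R) (l : R) :
  (forall s, is_derive s (1 : R) F (f s)) -> continuous f ->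
  (forall s, 0 <= s -> 0 <= f s) -> F s @[s --> +oo] --> l ->
  mu.-integrable `[0, +oo[ (fun s => (f s)%:E) /\
  \int[mu]_(s in `[0, +oo[) f s = l - F 0.
Proof.
move=> dF cf f0 Fl.
have cF : continuous F.
  by move=> s; apply/differentiable_continuous/derivable1_diffP; have [] := dF s.
have I : (\int[mu]_(s in `[0%R, +oo[) (f s)%:E = l%:E - (F 0)%:E)%E.
  apply: ge0_continuous_FTC2y => //.
  - exact: continuous_subspaceT.
  - exact: cvg_at_right_filter (cF 0).
  - by move=> s _; rewrite derive1E; have [_ ->] := dF s.
split; last by rewrite /Rintegral I -EFinB.
apply/integrableP; split.
  by apply/measurable_EFinP; apply: measurable_funTS; exact: continuous_measurable_fun.
under eq_integral => s.
  rewrite inE /= in_itv /= andbT => s0.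
  rewrite ger0_norm ?f0 //; over.
by rewrite I -EFinB ltry.
Qed.

(** Adding the majorant [e] makes the integrand nonnegative and its primitive [F + E] nondecreasing
    and bounded on s >= 0. The claims for [f] follow by subtracting those for [e]. *)
Lemma exp_decay_FTC (f F : R -> R) (C b : R) : 0 < b ->
  (forall s, is_derive s (1 : R) F (f s)) -> continuous f ->
  (forall s, 0 <= s -> `|f s| <= C * expR (- (b * s))) ->
  exists l : R, [/\ F s @[s --> +oo] --> l,
    mu.-integrable `[0, +oo[ (fun s => (f s)%:E) &
    \int[mu]_(s in `[0, +oo[) f s = l - F 0].
Proof.
move=> b0 dF cf fC.
have C0 : 0 <= C by have := fC 0 (lexx _); rewrite mulr0 oppr0 expR0 mulr1; apply: le_trans.
pose e s := C * expR (- (b * s)).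
pose E s := - (C / b) * expR (- (b * s)).
have e0 s : 0 <= e s by rewrite mulr_ge0 // expR_ge0.
have dexp s : is_derive s (1 : R) (fun s => expR (- (b * s))) (- b * expR (- (b * s))).
  have H : is_derive s (1 : R) (fun s => - (b * s)) (- b).
    have := is_derive_mul (is_derive_cst b s (1 : R)) (is_derive_id s (1 : R)).
    by rewrite mul0r add0r mulr1 => H; apply: is_deriveN.
  have := @is_derive1_comp _ expR (fun s => - (b * s)) s _ _ (is_derive_expR _) H.
  by rewrite mulrC.
have dE s : is_derive s (1 : R) E (e s).
  have := is_derive_mul (is_derive_cst (- (C / b)) s (1 : R)) (dexp s).
  rewrite mul0r add0r => H; apply: is_derive_eq; rewrite /cst /e; field.
  by rewrite gt_eqF.
have ce : continuous e.
  move=> s; apply: cvgM; first exact: cvg_cst.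
  have /differentiable_continuous : differentiable (fun s => expR (- (b * s))) s.
    by apply/derivable1_diffP; have [] := dexp s.
  exact.
have expl : expR (- (b * s)) @[s --> +oo] --> (0 : R).
  have H : (b * s) @[s --> +oo] --> +oo by exact: gt0_cvgMry.
  exact: (cvg_comp _ _ H (@cvgr_expR R)).
have El : E s @[s --> +oo] --> (0 : R).
  by rewrite -(mulr0 (- (C / b))); apply: cvgM => //; exact: cvg_cst.
have dH s : is_derive s (1 : R) (F + E) (f s + e s) by apply: is_deriveD.
have H0 s : 0 <= s -> 0 <= f s + e s.
  by move=> /fC; rewrite ler_norml -/(e s) => /andP[+ _]; rewrite lerNl -subr_ge0 opprK addrC.
have Hmono x y : 0 <= x -> x <= y -> (F + E) x <= (F + E) y.
  move=> x0 xy; rewrite -subr_ge0.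
  have [c] := mean_value xy (fun s _ => dH s).
  rewrite in_itv /= => /andP[xc _] ->; rewrite mulr_ge0 ?subr_ge0 // H0 //.
  exact: le_trans xc.
(* [F - E] is nonincreasing and [E] is nonpositive, so [F + E] stays below the initial value of
   [F - E]. *)
have Fle s : 0 <= s -> (F + E) s <= F 0 + C / b.
  move=> s0; have [c] := mean_value s0 (fun s _ => is_deriveB (dF s) (dE s)).
  rewrite in_itv /= => /andP[c0 _] cE.
  have : (F - E) s - (F - E) 0 <= 0.
    rewrite cE mulr_le0_ge0 ?subr_ge0 //.
    by rewrite subr_le0 (le_trans (ler_norm _)) // fC.
  have -> : (F - E) s - (F - E) 0 = F s - E s - (F 0 - E 0) by [].
  have -> : (F + E) s = F s + E s by [].
  have -> : E 0 = - (C / b) by rewrite /E mulr0 oppr0 expR0 mulr1.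
  have : E s <= 0 by rewrite /E mulNr oppr_le0 mulr_ge0 ?expR_ge0 // divr_ge0 // ltW.
  lra.
have [l Hl] : exists l : R, (F + E) s @[s --> +oo] --> l.
  (* Monotonicity is known for s >= 0 only; [g] is constant before 0. *)
  pose g s := (F + E) (Num.max s 0).
  exists (sup (range g)).
  have gc : g s @[s --> +oo] --> sup (range g).
    apply: nondecreasing_cvgr.
      move=> x y xy; apply: Hmono; first by rewrite le_max lexx orbT.
      by rewrite ge_max !le_max xy lexx orbT.
    exists (F 0 + C / b) => _ [s _ <-]; apply: Fle.
    by rewrite le_max lexx orbT.
  apply: cvg_trans gc; apply: near_eq_cvg.
  by apply: filterS (nbhs_pinfty_ge (num_real (0 : R))) => s s0; rewrite /g max_l.
have [ie Ie] := ge0_FTC_integrable dE ce (fun s _ => e0 s) El.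
have cH : continuous (fun s => f s + e s).
  by move=> s; apply: cvgD; [exact: cf|exact: ce].
have [ih Ih] := ge0_FTC_integrable dH cH H0 Hl.
have fE : (fun s => (f s)%:E) = (fun s => ((f s + e s) - e s)%:E).
  by apply/funext => s; rewrite addrK.
exists l; split.
- rewrite -[l]subr0.
  have -> : F = (fun s => (F + E) s - E s).
    by apply/funext => s; rewrite [(F + E) s]/(F s + E s) addrK.
  exact: cvgB.
- by rewrite fE; apply: (integrableB _ ih ie).
- have -> : \int[mu]_(s in `[0, +oo[) f s = \int[mu]_(s in `[0, +oo[) ((f s + e s) - e s).
    by apply: eq_Rintegral => s _; rewrite addrK.
  rewrite RintegralB // Ih Ie.
  have -> : (F + E) 0 = F 0 + E 0 by [].
  lra.
Qed.

End ExponentialDecay.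

(** * The entrywise norm on matrices *)

Section MatrixNorm.
Context {R : realType} {n : nat}.
Implicit Types M N : 'M[R]_n.

Lemma ler_mx_entry M i j : `|M i j| <= `|M|.
Proof.
rewrite [leRHS]/Num.Def.normr /= mx_normrE.
exact: (@le_bigmax _ _ _ _ (fun ij : 'I_n * 'I_n => `|M ij.1 ij.2|) (i, j)).
Qed.

Lemma ler_mx_norm M (e : R) : 0 <= e -> (forall i j, `|M i j| <= e) -> `|M| <= e.
Proof.
by move=> e0 H; rewrite [leLHS]/Num.Def.normr /= mx_normrE bigmax_le.
Qed.

(** The norm is the largest absolute value of an entry, and an entry of the product is a sum of n
    terms. *)
Lemma ler_norm_mulmx M N : `|M *m N| <= n%:R * (`|M| * `|N|).
Proof.
apply: ler_mx_norm => [|i j]; first by rewrite !mulr_ge0.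
rewrite mxE; apply: le_trans (ler_norm_sum _ _ _) _.
rewrite mulr_natl.
have -> : `|M| * `|N| *+ n = \sum_(l < n) `|M| * `|N| by rewrite sumr_const card_ord.
apply: ler_sum => l _; rewrite normrM ler_pM //; exact: ler_mx_entry.
Qed.

Lemma onorm1_mulmx M u : onorm 1%:M (M *m u) <= n%:R ^+ 2 * `|M| * onorm 1%:M u.
Proof.
rewrite /onorm !mul1mx; apply: enorm_mulmx_entry => i j; exact: ler_mx_entry.
Qed.

Lemma onorm_bound_norm (a : 'M[R]_n) : a \in unitmx -> exists2 c : R, 0 < c &
  forall M (m : R), 0 <= m -> (forall u, onorm a (M *m u) <= m * onorm a u) ->
  `|M| <= c * m.
Proof.
move=> /onorm_entry[c c0 H]; exists c => // M m m0 Mm.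
apply: ler_mx_norm => [|i j]; first by rewrite mulr_ge0 // ltW.
exact: H.
Qed.

(** The identity 1 - I = - I (1 - G) for I = G^-1 is used twice: it bounds I by 2 (1 + |1|) once n
    |1 - G| <= 1/2, and then makes 1 - I small. *)
Lemma cvg_invmx1 {T : Type} {F : set_system T} {FF : Filter F} (G : T -> 'M[R]_n) :
  G t @[t --> F] --> (1%:M : 'M[R]_n) -> (\forall t \near F, G t \in unitmx) ->
  invmx (G t) @[t --> F] --> (1%:M : 'M[R]_n).
Proof.
move=> G1 GU; apply/cvgrPdist_le => e e0.
pose d : R := Num.min 1 (e / 2) / (2 * (n%:R + 1)) / (1 + `|1%:M : 'M[R]_n|).
have n1 : 0 < n%:R + 1 :> R by rewrite ltr_wpDl.
have o1 : 0 < 1 + `|1%:M : 'M[R]_n| by rewrite ltr_pwDl.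
have m0 : 0 < Num.min 1 (e / 2) by rewrite lt_min ltr01 divr_gt0.
have d0 : 0 < d by rewrite !divr_gt0 // mulr_gt0.
move/cvgrPdist_le : G1 => /(_ _ d0) G1.
apply: filterS2 G1 GU => t Gd Gt.
set I := invmx (G t).
have IE : 1%:M - I = - (I *m (1%:M - G t)).
  by rewrite mulmxBr mulmx1 mulVmx // opprB.
have nd : n%:R * d <= Num.min 1 (e / 2) / 2 / (1 + `|1%:M : 'M[R]_n|).
  rewrite /d mulrA ler_pM2r ?invr_gt0 // mulrA ler_pdivrMr ?mulr_gt0 //.
  rewrite (_ : _ / 2 * (2 * (n%:R + 1)) = Num.min 1 (e / 2) * (n%:R + 1)); last by field.
  by rewrite mulrC ler_wpM2l ?(ltW m0) // lerDl.
set z := 1 + _ in o1 nd *.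
have hI : `|1%:M - I| <= n%:R * d * `|I|.
  rewrite IE normrN; apply: le_trans (ler_norm_mulmx _ _) _.
  by rewrite -mulrA ler_wpM2l // mulrC ler_wpM2r.
have z1 : 1 <= z by rewrite lerDl.
have zi : z^-1 <= 1 by rewrite invf_le1.
have q0 : 0 <= z^-1 by rewrite invr_ge0 ltW.
have nd2 : n%:R * d <= 1 / 2.
  apply: le_trans nd _; rewrite -[leRHS]mulr1 ler_pM //; first by rewrite divr_ge0 // ltW.
  by rewrite ler_wpM2r ?invr_ge0 // ge_min lexx.
have hI2 : `|I| <= 2 * z.
  have : `|I| <= `|1%:M : 'M[R]_n| + `|1%:M - I|.
    by rewrite -[I in leLHS](subKr 1%:M) (le_trans (ler_normB _ _)).
  have := ler_wpM2r (normr_ge0 I) nd2; rewrite /z; lra.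
apply: le_trans hI _.
apply: le_trans (ler_pM _ _ nd hI2) _ => //; first by rewrite mulr_ge0 // ltW.
rewrite (_ : Num.min 1 (e / 2) / 2 / z * (2 * z) = Num.min 1 (e / 2)); last by field; rewrite gt_eqF.
by rewrite ge_min; apply/orP; right; lra.
Qed.

End MatrixNorm.

(** * Exchange of the derivatives in t and along the flow *)

Section DerivativeOfLimit.
Context {R : realType} {n : nat}.
Variables (G Bt : R -> R -> 'M[R]_n) (A dB : R -> 'M[R]_n) (t1 : R).
Hypothesis t1_gt0 : 0 < t1.
Hypothesis GU : forall t s, `|t| < t1 -> G t s \in unitmx.
Hypothesis dG : forall t s, `|t| < t1 ->
  is_derive s (1 : R) (G t) (G t s *m Bt t s).
Hypothesis GA : forall s, t^-1 *: (G t s - 1%:M) @[t --> (0 : R)^'] --> A s.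
Hypothesis dB_cont : continuous dB.
Hypothesis Bt_dB : forall s0 (e : R), 0 < e -> \forall t \near (0 : R)^',
  forall s, `|s - s0| <= 1 -> `|dB s - t^-1 *: Bt t s| < e.

Lemma transport_cvg1 s : G t s @[t --> (0 : R)^'] --> (1%:M : 'M[R]_n).
Proof.
have t0 : t @[t --> (0 : R)^'] --> (0 : R) by exact: nbhs_dnbhs.
have H : t *: (t^-1 *: (G t s - 1%:M)) @[t --> (0 : R)^'] --> (0 *: A s).
  by apply: cvgZ; [exact: t0|exact: GA].
have H2 : t *: (t^-1 *: (G t s - 1%:M)) + 1%:M @[t --> (0 : R)^'] --> (0 *: A s + 1%:M).
  by apply: cvgD => //; exact: cvg_cst.
rewrite scale0r add0r in H2; apply: cvg_trans H2; apply: near_eq_cvg.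
apply: filterS (nbhs_dnbhs_neq (0 : R)) => t tn0.
by rewrite scalerA divff // scale1r subrK.
Qed.

(** The window around [s0] must not depend on [t]. The convergence of [G t] to the identity is known
    pointwise; the differential equation propagates it from [s0] to the whole window. *)
Let near_derivative s0 (e : R) : 0 < e -> exists2 d : R, 0 < d &
  \forall t \near (0 : R)^', forall s, `|s - s0| <= d ->
    `|t^-1 *: (G t s *m Bt t s) - dB s0| <= e.
Proof.
move=> e0.
(* A bound for t^-1 Bt on the window: it differs from [dB s0] by two errors of size at most 1, one
   from the continuity of [dB] and one from the convergence in [t]. *)
pose beta := `|dB s0| + 2.
have beta0 : 0 < beta by rewrite ltr_wpDl.
have [c1 c10 Hc1] := @onorm_bound_norm R n 1%:M (unitmx1 _ _).
pose e' := Num.min 1 (e / 4).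
have e'0 : 0 < e' by rewrite lt_min ltr01 divr_gt0.
have [d d0 dBd] : exists2 d : R, 0 < d & forall s, `|s - s0| <= d -> `|dB s0 - dB s| <= e'.
  move/cvgrPdist_le : (@dB_cont s0) => /(_ _ e'0) /nbhs_ballP[d /= d0 H].
  exists (d / 2) => [|s sd]; first by rewrite divr_gt0.
  by apply: H; rewrite -ball_normE /ball_ /= distrC (le_lt_trans sd) // gtr_pMr // invf_lt1 // ltr1n.
pose o : R := `|1%:M : 'M[R]_n| + 1.
have o0 : 0 < o by rewrite ltr_wpDl.
pose k0 : R := n%:R * (n%:R * (o * (c1 * (2 * (n%:R ^+ 2 * beta)))) + 1) * beta + 1.
have k1_ge0 : 0 <= n%:R * (o * (c1 * (2 * (n%:R ^+ 2 * beta)))) :> R.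
  by rewrite mulr_ge0 // mulr_ge0 ?(ltW o0) // mulr_ge0 ?(ltW c10) // mulr_ge0 // mulr_ge0 ?(ltW beta0) // sqr_ge0.
have k00 : 0 < k0.
  by rewrite ltr_wpDl // mulr_ge0 ?(ltW beta0) // mulr_ge0 // addr_ge0.
pose eta := Num.min 1 (e / 4 / k0).
have eta0 : 0 < eta by rewrite lt_min ltr01 !divr_gt0.
have b4 : 0 < (4 * (n%:R ^+ 2 * beta) + 1)^-1 :> R.
  by rewrite invr_gt0 ltr_wpDl // mulr_ge0 // mulr_ge0 ?(ltW beta0) // sqr_ge0.
exists (Num.min 1 d); first by rewrite lt_min ltr01 d0.
have /cvgrPdist_le /(_ _ eta0) n1 := transport_cvg1 s0.
have n2 := Bt_dB s0 e'0.
have n3 : \forall t \near (0 : R)^', `|t| < t1 by exact: dnbhs0_lt.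
have n4 : \forall t \near (0 : R)^', `|t| < eta by exact: dnbhs0_lt.
have n5 : \forall t \near (0 : R)^', `|t| < (4 * (n%:R ^+ 2 * beta) + 1)^-1.
  by exact: dnbhs0_lt.
have n6 := nbhs_dnbhs_neq (0 : R).
near=> t => s.
have G1 : `|1%:M - G t s0| <= eta by near: t.
have BB : forall s, `|s - s0| <= 1 -> `|dB s - t^-1 *: Bt t s| < e' by near: t.
have tt1 : `|t| < t1 by near: t.
have teta : `|t| < eta by near: t.
have t4 : `|t| < (4 * (n%:R ^+ 2 * beta) + 1)^-1 by near: t.
have tn0 : t != 0 by near: t.
rewrite le_min => /andP[s1 sd].
have tB r : `|r - s0| <= Num.min 1 d -> `|t^-1 *: Bt t r| <= beta.
  rewrite le_min => /andP[r1 rd].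
  have -> : t^-1 *: Bt t r = dB s0 - (dB s0 - dB r) - (dB r - t^-1 *: Bt t r).
    by rewrite opprB opprB (addrC (dB s0)) subrK addrCA subrr addr0.
  apply: le_trans (ler_normB _ _) _; rewrite /beta -[2]/(1 + 1) addrA lerD //.
    apply: le_trans (ler_normB _ _) _; rewrite lerD2l (le_trans (dBd _ rd)) //.
    by rewrite ge_min lexx.
  by rewrite (le_trans (ltW (BB _ r1))) // ge_min lexx.
have Bb r u : `|r - s0| <= `|s - s0| ->
    onorm 1%:M (Bt t r *m u) <= n%:R ^+ 2 * (`|t| * beta) * onorm 1%:M u.
  move=> rs; apply: le_trans (onorm1_mulmx _ _) _.
  rewrite ler_wpM2r ?onorm_ge0 // ler_wpM2l ?sqr_ge0 //.
  have -> : Bt t r = t *: (t^-1 *: Bt t r) by rewrite scalerA divff // scale1r.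
  rewrite normrZ ler_wpM2l // tB // (le_trans rs) // le_min s1 //.
have c0 : 0 <= n%:R ^+ 2 * (`|t| * beta) by rewrite mulr_ge0 ?sqr_ge0 // mulr_ge0 // ltW.
have small : 4 * (n%:R ^+ 2 * (`|t| * beta) * `|s - s0|) <= 1.
  apply: (@le_trans _ _ (4 * (n%:R ^+ 2 * (`|t| * beta)))).
    by rewrite ler_wpM2l // ler_piMr.
  have -> : 4 * (n%:R ^+ 2 * (`|t| * beta)) = `|t| * (4 * (n%:R ^+ 2 * beta)) by ring.
  have b5 : 0 < 4 * (n%:R ^+ 2 * beta) + 1 by rewrite -invr_gt0.
  apply: (@le_trans _ _ (`|t| * (4 * (n%:R ^+ 2 * beta) + 1))).
    by rewrite ler_wpM2l // lerDl.
  by rewrite -ler_pdivlMr // mul1r ltW.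
have := transport_close (unitmx1 _ _) (GU s0 tt1) (fun r => dG r tt1) c0 small Bb.
set Z := invmx (G t s0) *m G t s => HZ.
have Zle : `|Z - 1%:M| <= c1 * (2 * (n%:R ^+ 2 * beta)) * `|t|.
  apply: le_trans (Hc1 _ (2 * (n%:R ^+ 2 * (`|t| * beta) * `|s - s0|)) _ _) _.
  - by rewrite mulr_ge0 // mulr_ge0.
  - by move=> u; rewrite mulmxBl mul1mx; exact: HZ.
  - have -> : c1 * (2 * (n%:R ^+ 2 * beta)) * `|t| =
        c1 * (2 * (n%:R ^+ 2 * (`|t| * beta))) by ring.
    by apply: ler_wpM2l; [exact: ltW|apply: ler_wpM2l => //; exact: ler_piMr].
have GE : G t s - 1%:M = G t s0 *m (Z - 1%:M) - (1%:M - G t s0).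
  by rewrite mulmxBr mulmx1 /Z mulKVmx ?GU // opprB addrA subrK.
have Gs0 : `|G t s0| <= o.
  rewrite /o -[G t s0](subKr 1%:M); apply: le_trans (ler_normB _ _) _.
  by rewrite lerD2l (le_trans G1) // ge_min lexx.
have Gle : `|G t s - 1%:M| <= (n%:R * (o * (c1 * (2 * (n%:R ^+ 2 * beta)))) + 1) * eta.
  rewrite GE mulrDl mul1r; apply: le_trans (ler_normB _ _) _; rewrite lerD //.
  apply: le_trans (ler_norm_mulmx _ _) _.
  rewrite -mulrA; apply: ler_wpM2l => //; rewrite -mulrA; apply: ler_pM => //.
  apply: le_trans Zle _; apply: ler_wpM2l; last exact: ltW.
  by rewrite mulr_ge0 ?(ltW c10) // mulr_ge0 // mulr_ge0 ?sqr_ge0 // ltW.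
have -> : t^-1 *: (G t s *m Bt t s) - dB s0 =
    (G t s - 1%:M) *m (t^-1 *: Bt t s) - (dB s - t^-1 *: Bt t s) - (dB s0 - dB s).
  rewrite -scalemxAr mulmxBl mul1mx scalerBr !opprB.
  by rewrite !subrKA.
apply: le_trans (ler_normB _ _) _.
have h1 : `|dB s0 - dB s| <= e / 4 by rewrite (le_trans (dBd _ sd)) // ge_min lexx orbT.
have h2 : `|dB s - t^-1 *: Bt t s| <= e / 4.
  by rewrite (le_trans (ltW (BB _ s1))) // ge_min lexx orbT.
have h3 : `|(G t s - 1%:M) *m (t^-1 *: Bt t s)| <= e / 4.
  apply: le_trans (ler_norm_mulmx _ _) _.
  apply: (@le_trans _ _ (n%:R * ((n%:R * (o * (c1 * (2 * (n%:R ^+ 2 * beta)))) + 1) * eta * beta))).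
    by rewrite ler_wpM2l // ler_pM // tB // le_min s1.
  apply: (@le_trans _ _ (k0 * eta)).
    rewrite /k0 [leRHS]mulrDl mul1r; apply: ler_wpDr; first exact: ltW.
    by apply: eq_ler; ring.
  by rewrite mulrC -ler_pdivlMr // ge_min lexx orbT.
have := ler_normB ((G t s - 1%:M) *m (t^-1 *: Bt t s)) (dB s - t^-1 *: Bt t s).
lra.
Unshelve. all: by end_near.
Qed.

(** [A] is the pointwise limit of functions whose derivatives are uniformly close to [dB s] near
    [s]. The mean value inequality, after subtraction of the linear function with slope [dB s],
    bounds their difference quotients uniformly in t, and t tends to 0 with [r] fixed. *)
Lemma derive_first_variation s : is_derive s (1 : R) A (dB s).
Proof.
have [c c0 Hc] := @onorm_bound_norm R n 1%:M (unitmx1 _ _).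
apply/is_derive1P/cvgrPdist_le => e e0.
pose e' := e / (c * (n%:R ^+ 2 + 1)).
have n20 : 0 < n%:R ^+ 2 + 1 :> R by rewrite ltr_wpDl // sqr_ge0.
have e'0 : 0 < e' by rewrite divr_gt0 // mulr_gt0.
have [d d0 Hd] := near_derivative s e'0.
have n2 : \forall r \near (0 : R)^', `|r| <= d by exact: dnbhs0_le.
apply: filterS2 n2 (nbhs_dnbhs_neq (0 : R)) => r rd rn0.
have key : \forall t \near (0 : R)^',
    `|r^-1 *: (t^-1 *: (G t (s + r) - 1%:M) - t^-1 *: (G t s - 1%:M)) - dB s| <= e.
  have n1 : \forall t \near (0 : R)^', `|t| < t1 by exact: dnbhs0_lt.
  apply: filterS2 Hd n1 => t Ht tt1.
  have dF z : `|z| <= `|r| -> is_derive z (1 : R)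
      (fun z => t^-1 *: (G t (s + z * 1)) - z *: dB s)
      (t^-1 *: (G t (s + z) *m Bt t (s + z)) - dB s).
    move=> zr; have GG : is_derive (s + z * 1) (1 : R) (G t) (G t (s + z) *m Bt t (s + z)).
      by rewrite mulr1; apply: dG.
    have H1 := is_derive_affine GG; rewrite scale1r in H1.
    apply/is_derive_mxP => i j; rewrite !mxE.
    move/is_derive_mxP : H1 => /(_ i j); rewrite mxE => H1.
    have H2 := is_derive_mul (is_derive_cst t^-1 z (1 : R)) H1.
    have H3 := is_derive_mul (is_derive_id z (1 : R)) (is_derive_cst (dB s i j) z (1 : R)).
    have H4 := is_deriveB H2 H3.
    have -> : (fun z0 => (t^-1 *: G t (s + z0 * 1) - z0 *: dB s) i j) =
      (fun z0 => t^-1 * G t (s + z0 * 1) i j) - (fun z0 => z0 * dB s i j).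
      by apply/funext => z0; rewrite !mxE.
    by apply: is_derive_eq; rewrite mul0r add0r mulr0 addr0 mul1r.
  have Hu u := @mean_value_onorm R n 1%:M _ _ (n%:R ^+ 2 * e' * onorm 1%:M u) r u dF.
  have Fb : `|t^-1 *: (G t (s + r) - 1%:M) - t^-1 *: (G t s - 1%:M) - r *: dB s| <=
      c * (n%:R ^+ 2 * e' * `|r|).
    apply: Hc => [|u].
      by rewrite mulr_ge0 // mulr_ge0 ?sqr_ge0 // ltW.
    have -> : (t^-1 *: (G t (s + r) - 1%:M) - t^-1 *: (G t s - 1%:M) - r *: dB s) *m u =
      (t^-1 *: G t (s + r * 1) - r *: dB s) *m u - (t^-1 *: G t (s + 0 * 1) - 0 *: dB s) *m u.
      rewrite -mulmxBl mulr1 mul0r addr0 scale0r subr0; congr (_ *m u).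
      by apply/matrixP => i j; rewrite !mxE; ring.
    rewrite mulrAC; apply: Hu => z zr.
    apply: le_trans (onorm1_mulmx _ _) _; rewrite ler_wpM2r ?onorm_ge0 //.
    rewrite ler_wpM2l ?sqr_ge0 // Ht //.
    by rewrite addrC addKr (le_trans zr).
  have -> : r^-1 *: (t^-1 *: (G t (s + r) - 1%:M) - t^-1 *: (G t s - 1%:M)) - dB s =
    r^-1 *: (t^-1 *: (G t (s + r) - 1%:M) - t^-1 *: (G t s - 1%:M) - r *: dB s).
    by rewrite [RHS]scalerBr scalerA mulVf // scale1r.
  rewrite normrZ normfV ler_pdivrMl ?normr_gt0 //.
  apply: le_trans Fb _.
  rewrite (_ : c * (n%:R ^+ 2 * e' * `|r|) = `|r| * (c * n%:R ^+ 2 * e')); last by ring.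
  apply: ler_wpM2l => //.
  have -> : e = c * (n%:R ^+ 2 + 1) * e'.
    by rewrite /e'; field; rewrite !gt_eqF.
  by have := mulr_gt0 c0 e'0; lra.
have lim : `|r^-1 *: (t^-1 *: (G t (s + r) - 1%:M) - t^-1 *: (G t s - 1%:M)) - dB s|
    @[t --> (0 : R)^'] --> `|r^-1 *: (A (s + r) - A s) - dB s|.
  apply: cvg_norm; apply: cvgB; last exact: cvg_cst.
  by apply: cvgZr; apply: cvgB; exact: GA.
rewrite distrC; exact: (ler_cvg_to lim (cvg_cst e) key).
Qed.

End DerivativeOfLimit.

(** * Off-diagonal blocks and their limits at infinity *)

Section OffDiagonal.
Context {R : realType} {n : nat}.
Variables (a : R -> 'M[R]_n) (p pc : 'M[R]_n) (K B b : R).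
Hypothesis aU : forall s, a s \in unitmx.
Hypothesis K0 : 0 <= K.
Hypothesis B0 : 0 <= B.
Hypothesis b0 : 0 < b.
Hypothesis pK : forall s u, onorm (a s) (p *m u) <= K * onorm (a s) u.
Hypothesis pcK : forall s u, onorm (a s) (pc *m u) <= K * onorm (a s) u.
Hypothesis dom : dominated_orbit a p pc B b.

(** Domination from s to 0 compares [M *m (pc *m u)] with [u]; the norm of [pc *m u] at time s
    occurs on both sides and cancels. *)
Lemma offdiagonal_decay s (M : 'M[R]_n) (m : R) : s <= 0 -> 0 <= m ->
  (forall u, onorm (a s) (M *m u) <= m * onorm (a s) u) ->
  forall u, onorm (a 0) (p *m M *m pc *m u) <=
    B * K ^+ 2 * m * expR (b * s) * onorm (a 0) u.
Proof.
move=> s0 m0 Mm u.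
have C0 : 0 <= B * K ^+ 2 * m * expR (b * s).
  by rewrite mulr_ge0 ?expR_ge0 // mulr_ge0 // mulr_ge0 ?sqr_ge0.
have [v0|vn0] := eqVneq (pc *m u) 0.
  by rewrite -mulmxA v0 mulmx0 onorm0 mulr_ge0 ?onorm_ge0.
have v_gt0 := onorm_gt0 (aU s) vn0.
have H := dom (M *m (pc *m u)) u s0.
rewrite sub0r mulrN opprK in H.
rewrite -(ler_pM2r v_gt0) -!mulmxA; apply: le_trans H _.
set v := pc *m u in v_gt0 *.
have h1 : onorm (a s) (p *m (M *m v)) <= K * (m * onorm (a s) v).
  by apply: le_trans (pK _ _) _; rewrite ler_wpM2l.
have h2 : onorm (a 0) v <= K * onorm (a 0) u by exact: pcK.
have e0 := expR_ge0 (b * s).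
have h3 : onorm (a 0) v * onorm (a s) (p *m (M *m v)) <=
    K * onorm (a 0) u * (K * (m * onorm (a s) v)).
  by apply: ler_pM => //; exact: onorm_ge0.
apply: le_trans (ler_wpM2l (mulr_ge0 B0 e0) h3) _.
by apply: eq_ler; ring.
Qed.

(** [D t] is the difference quotient of the projectors, the same at all points of the geodesic. At
    each time s it is within bounded distance, uniformly in s, of a [U t] that converges to [W s].
    [A] and [W] are linked only through [pWpc], so that the reversed orbit with the opposite sign of
    [A] is an instance too. *)
Variables (A dA D W : R -> 'M[R]_n) (m C1 : R).
Hypothesis dA_A : forall s, is_derive s (1 : R) A (dA s).
Hypothesis dA_cont : continuous dA.
Hypothesis m0 : 0 <= m.
Hypothesis dA_m : forall s u, onorm (a s) (dA s *m u) <= m * onorm (a s) u.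
Hypothesis C10 : 0 <= C1.
Hypothesis pWpc : forall s, p *m W s *m pc = - (p *m A s *m pc).
Hypothesis DW : forall s, exists2 U : R -> 'M[R]_n,
  U t @[t --> (0 : R)^'] --> W s &
  \forall t \near (0 : R)^', forall u,
    onorm (a s) ((D t - U t) *m u) <= C1 * onorm (a s) u.

Let f s := p *m dA (- s) *m pc.
Let F s := - (p *m A (- s) *m pc).

Let dF s : is_derive s (1 : R) F (f s).
Proof.
have As : is_derive (0 + s * -1) (1 : R) A (dA (- s)) by rewrite add0r mulrN1.
have := is_derive_mulmxr pc (is_derive_mulmxl p (is_derive_affine As)).
rewrite scaleN1r mulmxN mulNmx => H.
have -> : F = - (fun s => p *m A (0 + s * -1) *m pc).
  by apply/funext => z; rewrite opprfctE /F add0r mulrN1.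
by rewrite -[f s]opprK; apply: is_deriveN.
Qed.

Let f_cont : continuous f.
Proof.
move=> s; apply: cvg_mulmx; last exact: cvg_cst.
apply: cvg_mulmx; first exact: cvg_cst.
apply: (@continuous_comp _ _ _ (fun z : R => - z) dA s); first exact: opp_continuous.
exact: dA_cont.
Qed.

Lemma offdiagonal_limit : exists l : 'M[R]_n,
  [/\ mx_integrable f, mx_integral f = l + p *m A 0 *m pc &
      p *m D t *m pc @[t --> (0 : R)^'] --> l].
Proof.
have [c c0 Hc] := onorm_bound_norm (aU 0).
have fle s : 0 <= s -> `|f s| <= c * (B * K ^+ 2 * m) * expR (- (b * s)).
  move=> s0; rewrite -mulrA; apply: Hc.
    by rewrite mulr_ge0 ?expR_ge0 // mulr_ge0 // mulr_ge0 ?sqr_ge0.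
  move=> u; rewrite -mulrN; apply: offdiagonal_decay => //.
  by rewrite oppr_le0.
have [l0 Hl] : exists l0 : 'I_n -> 'I_n -> R, forall i j, [/\ F s i j @[s --> +oo] --> l0 i j,
    lebesgue_measure.-integrable `[0, +oo[ (fun s => (f s i j)%:E) &
    \int[lebesgue_measure]_(s in `[0, +oo[) f s i j = l0 i j - F 0 i j].
  suff H i j : exists l : R, [/\ F s i j @[s --> +oo] --> l,
      lebesgue_measure.-integrable `[0, +oo[ (fun s => (f s i j)%:E) &
      \int[lebesgue_measure]_(s in `[0, +oo[) f s i j = l - F 0 i j].
    by exists (fun i j => sval (cid (H i j))) => i j; exact: svalP (cid (H i j)).
  apply: (@exp_decay_FTC R (fun s => f s i j) (fun s => F s i j) (c * (B * K ^+ 2 * m)) b b0).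
  - by move=> s; have /is_derive_mxP := dF s; apply.
  - by move=> s; have /cvg_mxP := @f_cont s; apply.
  - by move=> s s0; apply: le_trans (fle s s0); exact: ler_mx_entry.
pose l : 'M[R]_n := \matrix_(i, j) l0 i j.
have Fl : F s @[s --> +oo] --> l.
  by apply/cvg_mxP => i j; rewrite mxE; have [] := Hl i j.
exists l; split.
- by move=> i j; have [] := Hl i j.
- apply/matrixP => i j; rewrite mxE; have [_ _ ->] := Hl i j.
  have -> : F 0 i j = - (p *m A 0 *m pc) i j.
    by rewrite /F oppr0; set M := p *m _ *m _; rewrite mxE.
  by rewrite opprK [RHS]mxE [l i j]mxE.
apply/cvgrPdist_le => e e0.
have e3 : 0 < e / 3 by rewrite divr_gt0.
(* [S] is fixed before [t]: the error that is merely bounded at time - S is damped by domination,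
   and the convergence of [U] is then used at this single time. *)
have [S [S0 SF Se]] : exists S : R, [/\ 0 <= S, `|l - F S| <= e / 3 &
    c * (B * K ^+ 2 * C1) * expR (- (b * S)) <= e / 3].
  have n1 : \forall S \near +oo, `|l - F S| <= e / 3.
    by move/cvgrPdist_le : Fl; apply.
  have n2 : \forall S \near +oo, c * (B * K ^+ 2 * C1) * expR (- (b * S)) <= e / 3.
    have bS : (b * s) @[s --> +oo] --> +oo by exact: gt0_cvgMry.
    have expl : expR (- (b * s)) @[s --> +oo] --> (0 : R).
      exact: (cvg_comp _ _ bS (@cvgr_expR R)).
    have : c * (B * K ^+ 2 * C1) * expR (- (b * s)) @[s --> +oo] -->
        c * (B * K ^+ 2 * C1) * 0 by apply: cvgM => //; exact: cvg_cst.
    rewrite mulr0 => /cvgrPdist_le /(_ _ e3); apply: filterS => S.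
    by rewrite sub0r normrN; apply: le_trans; exact: ler_norm.
  have n3 : \forall S \near +oo, (0 : R) <= S by exact: nbhs_pinfty_ge.
  near (pinfty_nbhs R) => S; exists S; split; by near: S.
have [U UW DU] := DW (- S).
have n1 : \forall t \near (0 : R)^', `|F S - p *m U t *m pc| <= e / 3.
  have : p *m U t *m pc @[t --> (0 : R)^'] --> p *m W (- S) *m pc.
    by apply: cvg_mulmx (cvg_cst _); apply: cvg_mulmx UW; exact: cvg_cst.
  by rewrite pWpc => /cvgrPdist_le; apply.
near=> t.
have -> : l - p *m D t *m pc =
    (l - F S) + (F S - p *m U t *m pc) - p *m (D t - U t) *m pc.
  by rewrite subrKA mulmxBr mulmxBl opprB subrKA.
apply: le_trans (ler_normB _ _) _.
have h1 : `|p *m (D t - U t) *m pc| <= e / 3.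
  apply: le_trans Se; rewrite -mulrA; apply: Hc.
    by rewrite mulr_ge0 ?expR_ge0 // mulr_ge0 // mulr_ge0 ?sqr_ge0.
  move=> u; rewrite -mulrN; apply: offdiagonal_decay => //.
    by rewrite oppr_le0.
  by near: t.
have h2 : `|F S - p *m U t *m pc| <= e / 3 by near: t.
have := ler_normD (l - F S) (F S - p *m U t *m pc); lra.
Unshelve. all: by end_near.
Qed.

End OffDiagonal.

(** * The difference quotient of the projectors and its blocks *)

Section ProjectorQuotient.
Context {R : realType} {n : nat}.

Lemma cvg_projector_quotient (P : R -> 'M[R]_n) (p l1 l2 : 'M[R]_n) (C : R) :
  p *m p = p ->
  (\forall t \near (0 : R)^', P t *m P t = P t) ->
  (\forall t \near (0 : R)^', `|t^-1 *: (P t - p)| <= C) ->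
  p *m (t^-1 *: (P t - p)) *m (1%:M - p) @[t --> (0 : R)^'] --> l1 ->
  (1%:M - p) *m (t^-1 *: (P t - p)) *m p @[t --> (0 : R)^'] --> l2 ->
  t^-1 *: (P t - p) @[t --> (0 : R)^'] --> l1 + l2.
Proof.
move=> pp PP DC D1 D2; set pc := 1%:M - p in D1 D2.
have pcp : pc *m p = 0 by rewrite mulmxBl mul1mx pp subrr.
have ppc : p *m pc = 0 by rewrite mulmxBr mulmx1 pp subrr.
have ppc1 : p + pc = 1%:M by rewrite addrC subrK.
clearbody pc.
pose D t := t^-1 *: (P t - p).
have t0 : t @[t --> (0 : R)^'] --> (0 : R) by exact: nbhs_dnbhs.
have sq0 : t *: (D t *m D t) @[t --> (0 : R)^'] --> (0 : 'M[R]_n).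
  apply/cvgrPdist_le => e e0.
  have k0 : 0 < n%:R * C ^+ 2 + 1 by rewrite ltr_wpDl // mulr_ge0 // sqr_ge0.
  have e'0 : 0 < e / (n%:R * C ^+ 2 + 1) by rewrite divr_gt0.
  have n1 : \forall t \near (0 : R)^', `|t| < e / (n%:R * C ^+ 2 + 1).
    exact: dnbhs0_lt.
  apply: filterS2 DC n1 => t Dt te.
  rewrite sub0r normrN normrZ.
  have h : `|D t *m D t| <= n%:R * C ^+ 2.
    apply: le_trans (ler_norm_mulmx _ _) _; rewrite ler_wpM2l // expr2.
    exact: ler_pM.
  apply: (@le_trans _ _ (`|t| * (n%:R * C ^+ 2 + 1))).
    by rewrite ler_wpM2l // (le_trans h) // lerDl.
  by rewrite -ler_pdivlMr // ltW.
(* If P and p are idempotent then p (P - p)^2 p = - p (P - p) p and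
   (1 - p) (P - p)^2 (1 - p) = (1 - p) (P - p) (1 - p). *)
have E : \forall t \near (0 : R)^', D t =
    pc *m (t *: (D t *m D t)) *m pc - p *m (t *: (D t *m D t)) *m p +
    (p *m D t *m pc + pc *m D t *m p).
  apply: filterS2 PP (nbhs_dnbhs_neq (0 : R)) => t Pt tn0.
  have -> : t *: (D t *m D t) = t^-1 *: ((P t - p) *m (P t - p)).
    by rewrite /D -scalemxAl -scalemxAr scalerA divff // scale1r.
  rewrite /D -!(scalemxAl, scalemxAr) -!scalerN -!scalerDr; congr (_ *: _).
  have -> : (P t - p) *m (P t - p) = P t - P t *m p - (p *m P t - p).
    by rewrite mulmxBl !mulmxBr Pt pp.
  have s1 : pc *m (P t - P t *m p - (p *m P t - p)) *m pc = pc *m (P t - p) *m pc.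
    rewrite !mulmxBr !mulmxBl -!(mulmxA pc (_ *m p)) -!(mulmxA (P t)) ppc.
    by rewrite !mulmx0 !mulmxA pcp !mul0mx !subr0.
  have s2 : p *m (P t - P t *m p - (p *m P t - p)) *m p = - (p *m (P t - p) *m p).
    by rewrite !mulmxBr !mulmxBl !mulmxA pp -!(mulmxA _ p p) pp subrr sub0r.
  rewrite s1 s2 opprK.
  move: (P t - p) => X.
  rewrite -[X in X = _]mul1mx -[X in X = _]mulmx1 -ppc1 !mulmxDl !mulmxDr.
  set x1 := p *m X *m p; set x2 := pc *m X *m p; set x3 := p *m X *m pc.
  by apply/matrixP => i j; rewrite !mxE; ring.
suff H : pc *m (t *: (D t *m D t)) *m pc - p *m (t *: (D t *m D t)) *m p +
    (p *m D t *m pc + pc *m D t *m p) @[t --> (0 : R)^'] -->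
    pc *m (0 : 'M[R]_n) *m pc - p *m (0 : 'M[R]_n) *m p + (l1 + l2).
  rewrite !mulmx0 !mul0mx subr0 add0r in H.
  by apply: cvg_trans H; apply: near_eq_cvg; apply: filterS E => t.
apply: cvgD; last exact: cvgD.
apply: cvgB; (apply: cvg_mulmx; [|exact: cvg_cst]); (apply: cvg_mulmx => //; exact: cvg_cst).
Qed.

(** The origin of the bracket: (G - 1) q - q (G - 1) = G q - q G, and multiplying by G^-1 on the
    right gives P - q. With c = t^-1 the first factor tends to the bracket of [Adot] with [p]. *)
Lemma conj_quotient (G P : 'M[R]_n) (c : R) : G \in unitmx ->
  let q := invmx G *m P *m G in
  (c *: (G - 1%:M) *m q - q *m (c *: (G - 1%:M))) *m invmx G = c *: (P - q).
Proof.
move=> GU q.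
have GqG : G *m q *m invmx G = P by rewrite /q !mulmxA mulmxV // mul1mx mulmxK.
move: q GqG => q GqG.
rewrite -scalemxAl -scalemxAr -scalerBr -scalemxAl; congr (_ *: _).
rewrite (mulmxBl G) mul1mx (mulmxBr q) mulmx1 opprB subrKA.
by rewrite mulmxBl GqG mulmxK.
Qed.

(** Since [A, p] = (1 - p) A p - p A (1 - p), the bracket at x cancels the boundary terms of the two
    integrals at x, and only the limits at infinity remain. *)
Lemma bracket_integral_identity (A p l1 l2 : 'M[R]_n) :
  bracket A p + (l2 - (1%:M - p) *m A *m p) + (l1 + p *m A *m (1%:M - p)) = l1 + l2.
Proof.
rewrite /bracket !mulmxBl !mulmxBr !mulmx1 !mul1mx.
move: (A *m p) (p *m A) (p *m A *m p) => X Y Z.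
by apply/matrixP => i j; rewrite !mxE; ring.
Qed.

End ProjectorQuotient.

(** * The derivative of the fundamental projector *)

Theorem proposition3p0p1 (R : realType) (n k : nat) (eps : R)
    (h : R -> UH2 R -> 'M[R]_n) (p : R -> UH2 R -> 'M[R]_n)
    (Adot : UH2 R -> 'M[R]_n) :
  0 < eps ->
  uniformly_hyperbolic k trivial_connection (h 0) ->
  bounded_bundle_variation eps 2 (fun _ : R => trivial_connection) h ->
  (\forall t \near (0 : R),
     fundamental_projector k trivial_connection (h t) (p t)) ->
  (forall x, is_derive (0 : R) (1 : R) (fun t : R => h t x) (Adot x *m h 0 x)) ->
  forall x : UH2 R,
    let Iplus := fun s : R =>
      bracket_dA Adot (p 0) (arc_plus x) s *m p 0 (arc_plus x s) in
    let Iminus := fun s : R =>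
      p 0 (arc_minus x s) *m bracket_dA Adot (p 0) (arc_minus x) s in
    [/\ forall s : R, derivable (Adot \o arc_plus x) s 1,
        mx_integrable Iplus,
        mx_integrable Iminus &
        is_derive (0 : R) (1 : R) (fun t : R => p t x)
          (bracket (Adot x) (p 0 x) + mx_integral Iplus + mx_integral Iminus)].
Proof.
move=> eps0 _ var nfp hder x Iplus Iminus.
have [G [Bt [dB [C [t1 [[t1_gt0 C0] hG dG BtC [dB_cont dBC BtdB]]]]]]] :=
  bounded_variation_data eps0 var.
move: nfp => /nbhs_ballP[t2 /= t2_gt0 nfp].
pose t3 := Num.min t1 t2.
have t3_gt0 : 0 < t3 by rewrite lt_min t1_gt0.
have t31 (t : R) : `|t| < t3 -> `|t| < t1 by rewrite lt_min => /andP[].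
have hyp t : `|t| < t3 -> exists L P K B b c, hyperbolic_projector k (h t) (p t) L P K B b c.
  rewrite lt_min => /andP[_ tt2]; apply: fundamental_projector_hyperbolic.
  by apply: nfp; rewrite -ball_normE /ball_ /= sub0r normrN.
have [C1 [t4 [t4_gt0 t43 C10 close]]] := projector_close t3_gt0 C0
  (fun t x ht => hG t x (t31 t ht)) (fun t x s ht => dG t x s (t31 t ht))
  (fun t x u ht => BtC t x u (t31 t ht)) hyp.
have t03 : `|0 : R| < t3 by rewrite normr0.
have [L [P [K [B [b [c hp]]]]]] := hyp 0 t03.
have n4 : \forall t \near (0 : R)^', `|t| < t4 by exact: dnbhs0_lt.
have nn0 := nbhs_dnbhs_neq (0 : R).
pose y s := geodesic s x.
set p0 := p 0 x; pose pc := 1%:M - p0.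
have pp : p0 *m p0 = p0 := hyperbolic_projector_idem x hp.
have pcp : pc *m p0 = 0 by rewrite mulmxBl mul1mx pp subrr.
have ppc : p0 *m pc = 0 by rewrite mulmxBr mulmx1 pp subrr.
have pcE : 1%:M - p0 = pc by [].
have aU s : invmx (h 0 (y s)) \in unitmx by rewrite unitmx_inv (hp_unit hp).
have K0 : 0 <= K := le_trans ler01 (hp_K1 hp).
have B0 : 0 <= B := le_trans ler01 (hp_B1 hp).
have pK s u : onorm (invmx (h 0 (y s))) (p0 *m u) <= K * onorm (invmx (h 0 (y s))) u.
  by rewrite /p0 -(hp_flow hp x s) (hp_bound hp).
have pcK s u : onorm (invmx (h 0 (y s))) (pc *m u) <= K * onorm (invmx (h 0 (y s))) u.
  by rewrite /pc /p0 -(hp_flow hp x s) (hp_boundc hp).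
have dom : dominated_orbit (fun s => invmx (h 0 (y s))) p0 pc B b := hp_dom hp x.
clearbody pc.
(* As G_t = h_t h_0^-1, [Adot] is also the derivative of G_t at t = 0. *)
have GA s : t^-1 *: (G t (y s) - 1%:M) @[t --> (0 : R)^'] --> Adot (y s).
  have /is_derive1P H := hder (y s).
  have [h0U _ _] := hG 0 (y s) (t31 _ t03).
  have H2 : (r^-1 *: (h (0 + r) (y s) - h 0 (y s))) *m invmx (h 0 (y s))
      @[r --> (0 : R)^'] --> Adot (y s) *m h 0 (y s) *m invmx (h 0 (y s)).
    by apply: cvg_mulmx H _; exact: cvg_cst.
  rewrite mulmxK // in H2; apply: cvg_trans H2; apply: near_eq_cvg.
  apply: filterS n4 => t tt4; have [_ _ Gh] := hG t (y s) (t31 _ (lt_le_trans tt4 t43)).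
  by rewrite add0r -Gh -scalemxAl mulmxBl mulmxV // mulmxK.
have dA s : is_derive s (1 : R) (fun s => Adot (y s)) (dB (y s)).
  have yC := @continuous_geodesic R x.
  apply: (@derive_first_variation R n (fun t s => G t (y s)) (fun t s => Bt t (y s))
    (fun s => Adot (y s)) (fun s => dB (y s)) t1 t1_gt0 _
    (fun t z tt1 => dG t x z tt1) GA).
  - by move=> t z tt1; have [] := hG t (y z) tt1.
  - by move=> z; apply: (@continuous_comp _ _ _ y dB z); [exact: yC|exact: dB_cont].
  - move=> s0 e e0.
    (* Locally uniform convergence in s is obtained from uniform convergence on the image of a
       segment, which is compact in [UH2]. *)
    have cA : compact (y @` `[s0 - 1, s0 + 1]).
      apply: continuous_compact; last exact: segment_compact.
      exact: continuous_subspaceT.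
    have nA : \forall t \near (0 : R)^', forall w, (y @` `[s0 - 1, s0 + 1]) w ->
        `|dB w - t^-1 *: Bt t w| < e by exact: family_compact_dist BtdB cA e0.
    apply: filterS nA => t H z zs.
    apply: H; exists z => //=; rewrite in_itv /=.
    by move: zs; rewrite ler_distl.
have Adot_arc_plus s : (Adot \o arc_plus x)^`()%classic s = dB (y s).
  by rewrite derive1E; have [_ <-] := dA s.
have dA_minus s : is_derive s (1 : R) (fun s => Adot (y (- s))) (- dB (y (- s))).
  have As : is_derive (0 + s * -1) (1 : R) (fun s => Adot (y s)) (dB (y (- s))).
    by rewrite add0r mulrN1.
  have := is_derive_affine As; rewrite scaleN1r.
  by under eq_fun do rewrite add0r mulrN1.
have Adot_arc_minus s : (Adot \o arc_minus x)^`()%classic s = - dB (y (- s)).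
  by rewrite derive1E; have [_ <-] := dA_minus s.
pose q t s := invmx (G t (y s)) *m p t x *m G t (y s).
have ptflow t s : `|t| < t4 -> p t (y s) = p t x.
  move=> tt4; have [? [? [? [? [? [? hp']]]]]] := hyp t (lt_le_trans tt4 t43).
  exact: (hp_flow hp').
have qclose t s u : `|t| < t4 ->
    onorm (invmx (h 0 (y s))) ((q t s - p0) *m u) <= C1 * `|t| * onorm (invmx (h 0 (y s))) u.
  move=> tt4; have := close t (y s) u tt4.
  by rewrite ptflow // (hp_flow hp).
have q_p0 s : q t s @[t --> (0 : R)^'] --> p0.
  have [c' c'0 Hc] := onorm_bound_norm (aU s).
  apply/cvgrPdist_le => e e0.
  have k0 : 0 < c' * C1 + 1 by rewrite ltr_wpDl // mulr_ge0 // ltW.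
  have n5 : \forall t \near (0 : R)^', `|t| < e / (c' * C1 + 1).
    by apply: dnbhs0_lt; rewrite divr_gt0.
  apply: filterS2 n4 n5 => t tt4 te; rewrite distrC.
  apply: le_trans (Hc _ (C1 * `|t|) _ (fun u => qclose t s u tt4)) _.
    by rewrite mulr_ge0.
  apply: (@le_trans _ _ (`|t| * (c' * C1 + 1))); last by rewrite -ler_pdivlMr // ltW.
  rewrite (_ : c' * (C1 * `|t|) = `|t| * (c' * C1)); last by ring.
  by rewrite ler_wpM2l // lerDl.
(* The quotient splits as t^-1 (p_t - q_t) + t^-1 (q_t - p_0): the first term converges at each s,
   the second is bounded uniformly in s for the norm at s. *)
pose U s t := t^-1 *: (p t x - q t s).
have U_lim s : U s t @[t --> (0 : R)^'] --> bracket (Adot (y s)) p0.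
  have G1 := @transport_cvg1 R n (fun t s => G t (y s)) (fun s => Adot (y s)) GA s.
  have GU : \forall t \near (0 : R)^', G t (y s) \in unitmx.
    by apply: filterS n4 => t tt4; have [] := hG t (y s) (t31 _ (lt_le_trans tt4 t43)).
  have iG := cvg_invmx1 G1 GU.
  have H : (t^-1 *: (G t (y s) - 1%:M) *m q t s - q t s *m (t^-1 *: (G t (y s) - 1%:M)))
      *m invmx (G t (y s)) @[t --> (0 : R)^'] --> bracket (Adot (y s)) p0 *m 1%:M.
    apply: cvg_mulmx; last exact: iG.
    apply: cvgB; apply: cvg_mulmx; by [exact: GA|exact: q_p0].
  rewrite mulmx1 in H; apply: cvg_trans H; apply: near_eq_cvg.
  apply: filterS GU => t Gt.
  exact: conj_quotient.
pose D t := t^-1 *: (p t x - p0).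
have DU s : \forall t \near (0 : R)^', forall u,
    onorm (invmx (h 0 (y s))) ((D t - U s t) *m u) <= C1 * onorm (invmx (h 0 (y s))) u.
  apply: filterS2 n4 nn0 => t tt4 tn0 u.
  have -> : D t - U s t = t^-1 *: (q t s - p0).
    by rewrite /D /U -scalerBr opprB [X in _ *: X]addrC subrKA.
  rewrite -scalemxAl onormZ normfV ler_pdivrMl ?normr_gt0 //.
  by rewrite mulrA [_ * C1]mulrC qclose.
have dBy_cont : continuous (fun s => dB (y s)).
  move=> s; apply: (@continuous_comp _ _ _ y dB s); last exact: dB_cont.
  exact: continuous_geodesic.
have W1 s : p0 *m bracket (Adot (y s)) p0 *m pc = - (p0 *m Adot (y s) *m pc).
  by rewrite /bracket mulmxBr mulmxBl mulmxA -(mulmxA _ p0 pc) ppc mulmx0 sub0r !mulmxA pp.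
have [l1 [i1 I1 L1]] := offdiagonal_limit aU K0 B0 (hp_b0 hp) pK pcK dom dA dBy_cont
  (ltW C0) (fun s u => dBC (y s) u) C10 W1
  (fun s => ex_intro2 _ _ (U s) (U_lim s) (DU s)).
(* The other block is the same statement on the reversed orbit, with [p0] and [pc] exchanged. There
   the block of the bracket is that of + [Adot], so [Adot] enters with the opposite sign. *)
have dA' s : is_derive s (1 : R) (fun s => - Adot (y (- s))) (dB (y (- s))).
  by rewrite -[dB _]opprK; apply: is_deriveN.
have dBy_cont' : continuous (fun s => dB (y (- s))).
  move=> s; apply: (@continuous_comp _ _ _ (fun z : R => - z) (fun s => dB (y s)) s).
    exact: opp_continuous.
  exact: dBy_cont.
have W2 s : pc *m bracket (Adot (y (- s))) p0 *m p0 = - (pc *m (- Adot (y (- s))) *m p0).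
  rewrite /bracket mulmxBr mulmxBl (mulmxA pc p0) pcp !mul0mx subr0.
  by rewrite mulmxN mulNmx opprK -!mulmxA pp.
have [l2 [i2 I2 L2]] := offdiagonal_limit (fun s => aU (- s)) K0 B0 (hp_b0 hp)
  (fun s => pcK (- s)) (fun s => pK (- s)) (dominated_orbit_rev dom) dA' dBy_cont'
  (ltW C0) (fun s u => dBC (y (- s)) u) C10 W2
  (fun s => ex_intro2 _ _ (U (- s)) (U_lim (- s)) (DU (- s))).
(* By idempotence p [X, p] = - p X (1 - p), and the reversed arc contributes a second sign. *)
have IminusE : Iminus = fun s => p0 *m dB (y (- s)) *m pc.
  apply/funext => s; rewrite /Iminus /bracket_dA /bracket Adot_arc_minus.
  rewrite (hp_flow hp x (- s)) -/p0 -pcE mulNmx mulmxN opprK mulmxDr mulmxN.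
  by rewrite !mulmxA pp mulmxBr mulmx1 addrC.
(* Similarly [X, p] p = (1 - p) X p. The double negation is the integrand produced by the lemma on
   the reversed orbit. *)
have IplusE : Iplus = fun s => pc *m dB (y (- - s)) *m p0.
  apply/funext => s; rewrite /Iplus /bracket_dA /bracket Adot_arc_plus.
  rewrite (hp_flow hp x s) -/p0 -pcE opprK !mulmxBl mul1mx.
  by rewrite -(mulmxA _ p0 p0) pp.
have D_lim : D t @[t --> (0 : R)^'] --> l1 + l2.
  have [c' c'0 Hc] := onorm_bound_norm (aU 0).
  apply: (@cvg_projector_quotient R n (fun t => p t x) p0 l1 l2
    (`|bracket (Adot (y 0)) p0| + 1 + c' * C1)) => //; rewrite ?pcE //.
    apply: filterS n4 => t tt4.
    have [? [? [? [? [? [? hp']]]]]] := hyp t (lt_le_trans tt4 t43).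
    exact: hyperbolic_projector_idem hp'.
  have nU : \forall t \near (0 : R)^', `|bracket (Adot (y 0)) p0 - U 0 t| <= 1.
    by have /cvgrPdist_le := U_lim 0; apply.
  apply: filterS2 nU (DU 0) => t Ut DUt.
  rewrite -/(D t) -[D t](subrK (U 0 t)) addrC; apply: le_trans (ler_normD _ _) _.
  apply: lerD; last exact: Hc.
  rewrite -[U 0 t](subKr (bracket (Adot (y 0)) p0)).
  by apply: le_trans (ler_normB _ _) _; rewrite lerD2l.
have y0 : y 0 = x := geodesic0 x.
split.
- by move=> s; have [] := dA s.
- by rewrite IplusE.
- by rewrite IminusE.
apply/is_derive1P.
rewrite IplusE IminusE I1 I2 oppr0 y0 -pcE mulmxN mulNmx bracket_integral_identity.
by under eq_fun do rewrite add0r.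
Qed.
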